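(* Let $A\in\mathbb K^{m\times n}$, let $1\le h\le \operatorname{rank}(A)$, and let $0\le j<h\le k\le\operatorname{rank}(A)$ be the indices $j=j(h)$, $k=k(h)$ defined in the context. Let $A=U\Sigma V^*$ be a full SVD. Let $t\ge 0$ and let $\phi(x)\in\mathbb K[x]$ be a polynomial of degree at most $2t+1$ with odd powers only, such that $\phi(\sigma_1),\ldots,\phi(\sigma_k)>0$. Let $X\in\mathbb K^{n\times r}$ be such that $(A,X)$ is $h$-compatible and let $\mathcal K_t=\mathcal K_t(A,X)$. Then there exists an $h$-dimensional left dominant subspace $\mathcal S'$ for $A$ such that $$\|\sin\Theta(\mathcal K_t,\mathcal S')\|_{2,F}\le 2\,\|\sin\Theta(R(V_k^*X),V_k^*\mathcal V_j)\|_{2,F}+\|\phi(\Sigma_{k,\perp})\|_2\,\|\phi(\Sigma_k)^{-1}\|_2\,\|V_{k,\perp}^*X(V_k^*X)^\dagger\|_{2,F}.$$ In case $j=0$ (respectively $k=\operatorname{rank}(A)$) the first term (respectively the second term) is omitted in this upper bound. Moreover, one has the inequality (between diagonal matrices, entrywise on the diagonal) $$\Theta(R(V_k^*X),V_k^*\mathcal V_j)\le\Theta(R(X),\mathcal V_j).$$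
   Context: $\mathbb K=\mathbb R$ or $\mathbb C$; $p=\min\{m,n\}$; $\sigma_1\ge\dots\ge\sigma_p\ge0$ are the singular values of $A$, and $\sigma_0=+\infty$. $j=j(h)=\max\{0\le\ell<h:\sigma_\ell>\sigma_h\}$ and $k=k(h)=\max\{1\le\ell\le\operatorname{rank}(A):\sigma_\ell=\sigma_h\}$. $A=U\Sigma V^*$ is a full SVD: $U\in\mathbb K^{m\times m}$, $V\in\mathbb K^{n\times n}$ unitary, $\Sigma\in\mathbb R^{m\times n}$ (rectangular) diagonal with diagonal entries $\sigma_1,\dots,\sigma_p$. For $1\le\ell\le\operatorname{rank}(A)$: $V_\ell$ consists of the first $\ell$ columns of $V$ and $V_{\ell,\perp}$ of the remaining ones; $\Sigma_\ell=\mathrm{diag}(\sigma_1,\dots,\sigma_\ell)$ and $\Sigma_{\ell,\perp}$ is the complementary lower-right diagonal block of $\Sigma$; $\mathcal V_\ell=R(V_\ell)$. For a polynomial $\phi$ with odd powers only, $\phi(\Sigma_k)$ and $\phi(\Sigma_{k,\perp})$ are the diagonal matrices (of the same sizes as $\Sigma_k$, $\Sigma_{k,\perp}$) obtained by applying $\phi$ to the diagonal entries. $R(\cdot)$ denotes range, $Z^\dagger$ the Moore-Penrose pseudo-inverse, $\|\cdot\|_2$ and $\|\cdot\|_F$ the spectral and Frobenius norms; a statement with $\|\cdot\|_{2,F}$ is asserted for each of the two norms (the same choice throughout). Principal angles: for subspaces $\mathcal S,\mathcal T\subset\mathbb K^N$ with orthonormal-column basis matrices $S,T$, and $d=\min\{\dim\mathcal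 S,\dim\mathcal T\}$, the angles $0\le\theta_1\le\dots\le\theta_d\le\pi/2$ are given by $\cos\theta_i(\mathcal S,\mathcal T)=\sigma_i(S^*T)$; $\Theta(\mathcal S,\mathcal T)=\mathrm{diag}(\theta_1,\dots,\theta_d)$, and $\sin\Theta$ is taken entrywise on the diagonal. Dominant subspaces: an $h$-dimensional $\mathcal S'\subset\mathbb K^m$ is a left dominant subspace for $A$ if it has an orthonormal basis $w_1,\dots,w_h$ with $AA^*w_i=\sigma_i^2w_i$, $1\le i\le h$. An $h$-dimensional $\mathcal S\subset\mathbb K^n$ is a right dominant subspace for $A$ if it has an orthonormal basis $z_1,\dots,z_h$ with $A^*Az_i=\sigma_i^2z_i$, $1\le i\le h$. $h$-compatibility: $(A,X)$ is $h$-compatible if there is an $h$-dimensional right dominant subspace $\mathcal S$ for $A$ with $\Theta(\mathcal S,R(X))<\frac{\pi}{2}I$; this is understood as $\operatorname{rank}(X)\ge h$ and all $h$ principal angles being $<\pi/2$, equivalently $\dim(X^*\mathcal S)=h$. Block Krylov space: $\mathcal K_t(A,X)=R\big(\,AX\ \ (AA^* )AX\ \cdots\ (AA^* )^tAX\,\big)\subset\mathbb K^m$. *)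

(* Defs.v *)
From HB Require Import structures.
From mathcomp Require Import all_boot all_order all_algebra.
From mathcomp Require Import all_classical all_reals all_analysis.
From mathcomp Require Import complex.

Set Implicit Arguments.
Unset Strict Implicit.
Unset Printing Implicit Defensive.

Import Order.TTheory GRing.Theory Num.Theory.

Local Open Scope ring_scope.

(* K = R or C. *)
Inductive scalar_kind := OverReal | OverComplex.

Definition RorC (R : realType) (b : scalar_kind) : numFieldType :=
  match b with
  | OverReal => R
  | OverComplex => R[i]%type
  end.

Definition sc_conj (R : realType) (b : scalar_kind) :
    RorC R b -> RorC R b :=
  match b return RorC R b -> RorC R b with
  | OverReal => fun x : R => x
  | OverComplex => fun z : R[i] => conjc z
  end.

Definition sc_abs (R : realType) (b : scalar_kind) : RorC R b -> R :=
  match b return RorC R b -> R with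
  | OverReal => fun x : R => `|x|
  | OverComplex => fun z : R[i] => let: Complex x y := z in
                                      Num.sqrt (x ^+ 2 + y ^+ 2)
  end.

Definition sc_of_real (R : realType) (b : scalar_kind) : R -> RorC R b :=
  match b return R -> RorC R b with
  | OverReal => fun x : R => x
  | OverComplex => fun x : R => real_complex R x
  end.

Section MatrixNotions.
Variables (R : realType) (b : scalar_kind).
Local Notation K := (RorC R b).

Definition adj m n (M : 'M[K]_(m, n)) : 'M[K]_(n, m) :=
  (map_mx (@sc_conj R b) M)^T.

Definition orthonormal_cols m n (Q : 'M[K]_(m, n)) : Prop :=
  adj Q *m Q = 1%:M.

(* Unitary matrices are the square matrices with orthonormal columns. *)
Definition unitary n (U : 'M[K]_n) : Prop := orthonormal_cols U.

(* Rectangular diagonal matrix; entries beyond the end of s are 0. *)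
Definition rdiag m n (s : seq K) : 'M[K]_(m, n) :=
  \matrix_(i, c) (if i == c :> nat then s`_i else 0).

Definition is_svals m n (M : 'M[K]_(m, n)) (s : seq R) : Prop :=
  [/\ size s = minn m n, sorted >=%R s, all (>= 0) s &
      exists (U : 'M[K]_m) (V : 'M[K]_n),
        [/\ unitary U, unitary V &
            M = U *m rdiag m n (map (@sc_of_real R b) s) *m adj V]].

(* The unique such sequence, stored 0-based: [:: sigma_1; ...; sigma_p]. *)
Definition svals m n (M : 'M[K]_(m, n)) : seq R :=
  xget [::] [set s | is_svals M s]%classic.

(* 1-based: sigma M 0 = +oo, sigma M l = sigma_l for 1 <= l <= min(m, n)
   (and 0 beyond). *)
Definition sigma m n (M : 'M[K]_(m, n)) (l : nat) : \bar R :=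
  if l is l'.+1 then ((svals M)`_l')%:E else +oo%E.

Definition sigmaK m n (M : 'M[K]_(m, n)) (l : nat) : K :=
  sc_of_real b (fine (sigma M l)).

Definition Sigma m n (M : 'M[K]_(m, n)) : 'M[K]_(m, n) :=
  rdiag m n (map (@sc_of_real R b) (svals M)).

Definition full_svd m n (M : 'M[K]_(m, n)) (U : 'M[K]_m) (V : 'M[K]_n) : Prop :=
  [/\ unitary U, unitary V & M = U *m Sigma M *m adj V].

Definition j_index m n (M : 'M[K]_(m, n)) (h : nat) : nat :=
  (\max_(0 <= l < h | (sigma M h < sigma M l)%E) l)%N.

Definition k_index m n (M : 'M[K]_(m, n)) (h : nat) : nat :=
  (\max_(1 <= l < (\rank M).+1 | sigma M l == sigma M h) l)%N.

(* The blocks below are meant for l <= min(m, n); out-of-range indices, which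
   do not occur then, are filled with 0. *)
Definition entry m n (M : 'M[K]_(m, n)) (i c : nat) : K :=
  if (insub i, insub c) is (Some i', Some c') then M i' c' else 0.

Definition first_cols (l : nat) m n (M : 'M[K]_(m, n)) : 'M[K]_(m, l) :=
  \matrix_(i, c) entry M i c.

Definition last_cols (l : nat) m n (M : 'M[K]_(m, n)) : 'M[K]_(m, n - l) :=
  \matrix_(i, c) entry M i (l + c).

Definition ul_block (l : nat) m n (M : 'M[K]_(m, n)) : 'M[K]_l :=
  \matrix_(i, c) entry M i c.

Definition lr_block (l : nat) m n (M : 'M[K]_(m, n)) : 'M[K]_(m - l, n - l) :=
  \matrix_(i, c) entry M (l + i) (l + c).

(* phi(D) for a (rectangular) diagonal D: phi acts on the diagonal entries only,
   which for non-square D is not polynomial evaluation. *)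
Definition diag_apply (phi : {poly K}) m n (D : 'M[K]_(m, n)) : 'M[K]_(m, n) :=
  \matrix_(i, c) (if i == c :> nat then phi.[D i c] else 0).

Definition penrose m n (Z : 'M[K]_(m, n)) (Y : 'M[K]_(n, m)) : Prop :=
  [/\ Z *m Y *m Z = Z, Y *m Z *m Y = Y,
      adj (Z *m Y) = Z *m Y & adj (Y *m Z) = Y *m Z].

Definition mp_inverse m n (Z : 'M[K]_(m, n)) : 'M[K]_(n, m) :=
  xget 0 [set Y | penrose Z Y]%classic.

(* Subspaces of K^N are subspaces of 'cV_N. *)
Definition mximage m n (M : 'M[K]_(m, n)) (S : {vspace 'cV[K]_n}) :
    {vspace 'cV[K]_m} :=
  (linfun (mulmx M : 'cV[K]_n -> 'cV[K]_m) @: S)%VS.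

Definition colrange m n (M : 'M[K]_(m, n)) : {vspace 'cV[K]_m} :=
  mximage M fullv.

Definition is_onb N d (S : {vspace 'cV[K]_N}) (Q : 'M[K]_(N, d)) : Prop :=
  orthonormal_cols Q /\ colrange Q = S.

Definition onb_mx N (S : {vspace 'cV[K]_N}) : 'M[K]_(N, \dim S) :=
  xget 0 [set Q | is_onb S Q]%classic.

(* [:: theta_1; ...; theta_d] with d = min(dim S, dim T); independent of the
   orthonormal bases chosen by onb_mx. *)
Definition Theta N (S T : {vspace 'cV[K]_N}) : seq R :=
  map acos (svals (adj (onb_mx S) *m onb_mx T)).

Definition left_dominant m n (A : 'M[K]_(m, n)) (h : nat)
    (S : {vspace 'cV[K]_m}) : Prop :=
  \dim S = h /\
  exists W : 'M[K]_(m, h), is_onb S W /\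
    forall i : 'I_h,
      A *m adj A *m col i W = sigmaK A i.+1 ^+ 2 *: col i W.

Definition right_dominant m n (A : 'M[K]_(m, n)) (h : nat)
    (S : {vspace 'cV[K]_n}) : Prop :=
  \dim S = h /\
  exists Z : 'M[K]_(n, h), is_onb S Z /\
    forall i : 'I_h,
      adj A *m A *m col i Z = sigmaK A i.+1 ^+ 2 *: col i Z.

Definition h_compatible m n r (A : 'M[K]_(m, n)) (X : 'M[K]_(n, r)) (h : nat) :
    Prop :=
  exists S : {vspace 'cV[K]_n},
    [/\ right_dominant A h S, (h <= \rank X)%N &
        all (fun theta => theta < pi / 2) (Theta S (colrange X))].

Definition krylov m n r (t : nat) (A : 'M[K]_(m, n)) (X : 'M[K]_(n, r)) :
    {vspace 'cV[K]_m} :=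
  colrange (\mxrow_(i < t.+1) ((A *m adj A) ^+ i *m A *m X)).

End MatrixNotions.

Inductive norm_kind := Spectral | Frobenius.

Definition mxnorm (nu : norm_kind) (R : realType) (b : scalar_kind) m n
    (M : 'M[RorC R b]_(m, n)) : R :=
  match nu with
  | Spectral => (svals M)`_0
  | Frobenius => Num.sqrt (\sum_i \sum_c sc_abs (M i c) ^+ 2)
  end.

Definition sin_Theta (R : realType) (b : scalar_kind) N
    (S T : {vspace 'cV[RorC R b]_N}) :
    'M[RorC R OverReal]_(size (Theta S T)) :=
  @rdiag R OverReal _ _ (map sin (Theta S T)).

(* Main.v *)
Require Import Defs.
From HB Require Import structures.
From mathcomp Require Import all_boot all_order all_algebra.
From mathcomp Require Import all_classical all_reals all_analysis.
From mathcomp Require Import perm complex ring lra zify.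

Set Implicit Arguments.
Unset Strict Implicit.
Unset Printing Implicit Defensive.

Import Order.TTheory GRing.Theory Num.Theory.

Local Open Scope ring_scope.

(** Put Z = V_k^* X, W = R(Z) and let E_j be the span of the first j coordinate
    vectors of K^k, so that V_k^* V_j = E_j.  A subspace U_k T is left dominant as
    soon as T contains E_j, because sigma_(j+1) = .. = sigma_k (left_dominant_frame).
    Compatibility gives dim W >= h (compatible_rank), hence there is such a T of
    dimension h whose remaining vectors lie in W and are orthogonal to E_j
    (exists_frame).

    The values of phi at sigma_1, .., sigma_j may be tiny compared with
    phi(sigma_h), in which case the range of phi(A) X can be far from every
    dominant subspace.  But the Krylov space contains psi(A) X for all odd psi of
    degree at most 2t + 1, and phi can be replaced by a real psi with
    psi(sigma_h) = 1, psi >= 1 on [sigma_h, oo) and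
    |psi| <= |phi| / phi(sigma_h) on [0, sigma_h] (monotone_filter).  Indeed write
    phi(x) = x g(x^2) and g(y) = g(y0) prod (1 - (y0 - y) gam_i), where
    y0 = sigma_h^2 and gam_i = 1 / (y0 - rho_i) for the roots rho_i of g:
    replacing each gam_i by the positive part of its real part can only
    decrease every factor in modulus for y <= y0 and makes it at least 1 for y >= y0
    (linear_factor_minorant).

    Let D = psi(Sigma_k): it is diagonal, D >= 1, and D = 1 on the complement of
    E_j.  Then D W is at least as close to T as W is to E_j
    (stretched_frame_gap).  If G = D^-1 P_(DW) T, where P_(DW) projects onto D W,
    the columns of psi(A) X Z^+ G lie in the Krylov space and differ from U_k T by
    U_k (1 - P_(DW)) T, whose norm is at most that of sin Theta(W, E_j), and by a
    tail U_(k,perp) psi(Sigma_(k,perp)) V_(k,perp)^* X Z^+ G, for which |G| <= 1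
    (krylov_sin_bound).

    The norms are handled through one comparison principle (svals_comparison,
    mxnorm_comparison), a form of the Courant-Fischer theorem that orders all the
    singular values of two matrices of different shapes.  It yields the
    uniqueness of singular values, the bounds for products, the gap estimate and
    also the comparison of angles (Theta_compression).  The sines enter through
    |sin Theta(S, T)| = |(1 - P_S) T| for an orthonormal basis of the smaller
    subspace T (mxnorm_sin_Theta).  The singular value decomposition itself is
    obtained by diagonalizing M^* M (svals_exist). *)

(** * Scalars *)

Section Scalars.
Variables (R : realType) (b : scalar_kind).
Local Notation K := (RorC R b).
Local Notation conj := (@sc_conj R b).
Local Notation ofR := (@sc_of_real R b).

Lemma sc_conj_zmod_morphism : zmod_morphism conj.
Proof. by case: b => // x y /=; rewrite rmorphB. Qed.

Lemma sc_conj_monoid_morphism : monoid_morphism conj.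
Proof. by case: b; split; [|move=> x y| exact: rmorph1 | exact: rmorphM]. Qed.

HB.instance Definition _ :=
  GRing.isZmodMorphism.Build K K conj sc_conj_zmod_morphism.
HB.instance Definition _ :=
  GRing.isMonoidMorphism.Build K K conj sc_conj_monoid_morphism.

Lemma sc_of_real_zmod_morphism : zmod_morphism ofR.
Proof. by case: b => // x y /=; rewrite rmorphB. Qed.

Lemma sc_of_real_monoid_morphism : monoid_morphism ofR.
Proof. by case: b; split; [|move=> x y| exact: rmorph1 | exact: rmorphM]. Qed.

HB.instance Definition _ :=
  GRing.isZmodMorphism.Build R K ofR sc_of_real_zmod_morphism.
HB.instance Definition _ :=
  GRing.isMonoidMorphism.Build R K ofR sc_of_real_monoid_morphism.

Lemma sc_conjK : involutive conj.
Proof. by case: b => // x; exact: conjcK. Qed.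

Lemma sc_conj_of_real x : conj (ofR x) = ofR x.
Proof. by case: b => //; exact: conjc_real. Qed.

Lemma sc_of_real_inj : injective ofR.
Proof. exact: fmorph_inj. Qed.

Lemma sc_of_real_eq0 x : (ofR x == 0) = (x == 0).
Proof. exact: fmorph_eq0. Qed.

Lemma sc_abs_ge0 (x : K) : 0 <= sc_abs x.
Proof. by move: x; case: b => [x|[x y]] //=; rewrite sqrtr_ge0. Qed.

Lemma sc_absE (x : K) : ofR (sc_abs x ^+ 2) = conj x * x.
Proof.
move: x; case: b => [x|[x y]] /=; first by rewrite real_normK ?num_real.
rewrite sqr_sqrtr ?addr_ge0 ?sqr_ge0//.
by apply/eqP; rewrite eq_complex /=; apply/andP; split; apply/eqP; ring.
Qed.

Lemma sc_absM (x y : K) : sc_abs (x * y) = sc_abs x * sc_abs y.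
Proof.
apply/eqP; rewrite -(@eqrXn2 _ 2) ?mulr_ge0 ?sc_abs_ge0 //; apply/eqP.
apply: sc_of_real_inj.
by rewrite exprMn [RHS]rmorphM !sc_absE (rmorphM conj) /= (sc_absE x) (sc_absE y); ring.
Qed.

Lemma sc_abs_of_real x : sc_abs (ofR x) = `|x|.
Proof. by case: b => //=; rewrite expr0n addr0 sqrtr_sqr. Qed.

Lemma sc_abs0 : sc_abs (0 : K) = 0.
Proof. by rewrite -(rmorph0 ofR) sc_abs_of_real normr0. Qed.

Lemma sc_abs_conj (x : K) : sc_abs (conj x) = sc_abs x.
Proof. by move: x; case: b => [x|[x y]] //=; rewrite sqrrN. Qed.

Lemma sc_absN (x : K) : sc_abs (- x) = sc_abs x.
Proof. by move: x; case: b => [x|[x y]] /=; rewrite ?normrN ?sqrrN. Qed.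

Lemma sc_abs_eq0 (x : K) : (sc_abs x == 0) = (x == 0).
Proof.
move: x; case: b => [x|[x y]] /=; first by rewrite normr_eq0.
by rewrite sqrtr_eq0 eq_complex /= le_eqVlt paddr_eq0 ?sqr_ge0 // !sqrf_eq0
   ltNge addr_ge0 ?sqr_ge0 // orbF.
Qed.

Lemma sc_abs_triangle (x y : K) : sc_abs (x + y) <= sc_abs x + sc_abs y.
Proof.
move: x y; case: b => [x y|x y] /=; first exact: ler_normD.
exact: (@complex.le_normcD R x y).
Qed.

End Scalars.

(** * Adjoints and the Frobenius norm *)

Section Adjoint.
Variables (R : realType) (b : scalar_kind).
Local Notation K := (RorC R b).
Local Notation ofR := (@sc_of_real R b).

Lemma adjE m n (M : 'M[K]_(m, n)) i c : adj M i c = sc_conj (M c i).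
Proof. by rewrite !mxE. Qed.

Lemma adjK m n (M : 'M[K]_(m, n)) : adj (adj M) = M.
Proof. by apply/matrixP => i c; rewrite !adjE sc_conjK. Qed.

Lemma adjM m n p (M : 'M[K]_(m, n)) (N : 'M[K]_(n, p)) :
  adj (M *m N) = adj N *m adj M.
Proof. by rewrite /adj map_mxM trmx_mul. Qed.

Lemma adjD m n (M N : 'M[K]_(m, n)) : adj (M + N) = adj M + adj N.
Proof. by rewrite /adj map_mxD linearD. Qed.

Lemma adjB m n (M N : 'M[K]_(m, n)) : adj (M - N) = adj M - adj N.
Proof. by rewrite /adj map_mxB linearB. Qed.

Lemma adjZ m n (a : K) (M : 'M[K]_(m, n)) : adj (a *: M) = sc_conj a *: adj M.
Proof. by apply/matrixP => i c; rewrite adjE !mxE rmorphM. Qed.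

Lemma col_mul m n p (M : 'M[K]_(m, n)) (N : 'M[K]_(n, p)) c :
  col c (M *m N) = M *m col c N.
Proof. by rewrite !colE mulmxA. Qed.

Lemma adj_row_mx m n p (M : 'M[K]_(m, n)) (N : 'M[K]_(m, p)) :
  adj (row_mx M N) = col_mx (adj M) (adj N).
Proof. by rewrite /adj map_row_mx tr_row_mx. Qed.

Lemma adj1 n : adj 1%:M = 1%:M :> 'M[K]_n.
Proof. by rewrite /adj map_mx1 trmx1. Qed.

Lemma adj0 m n : adj 0 = 0 :> 'M[K]_(n, m).
Proof. by rewrite /adj map_mx0 trmx0. Qed.

Lemma unitary_mul_adj n (U : 'M[K]_n) : unitary U -> U *m adj U = 1%:M.
Proof. exact: mulmx1C. Qed.

Lemma unitary_adj n (U : 'M[K]_n) : unitary U -> unitary (adj U).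
Proof. by move=> /unitary_mul_adj UU; rewrite /unitary /orthonormal_cols adjK. Qed.

Lemma orthonormal_mul m n p (P : 'M[K]_(m, n)) (Q : 'M[K]_(n, p)) :
  orthonormal_cols P -> orthonormal_cols Q -> orthonormal_cols (P *m Q).
Proof.
by move=> PP QQ; rewrite /orthonormal_cols adjM -mulmxA (mulmxA (adj P)) PP mul1mx.
Qed.

Lemma rank_orthonormal m n (Q : 'M[K]_(m, n)) :
  orthonormal_cols Q -> \rank Q = n.
Proof.
move=> QQ; apply/eqP; rewrite eqn_leq rank_leq_col -[X in (X <= _)%N](mxrank1 K).
by rewrite -QQ mxrankM_maxr.
Qed.

(** Kept squared and real-valued, so that Pythagoras' identity and isometry
    invariance are equations between reals; vectors are the case n = 1. *)
Definition fro2 m n (M : 'M[K]_(m, n)) : R := \sum_i \sum_c sc_abs (M i c) ^+ 2.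

Lemma fro2E m n (M : 'M[K]_(m, n)) : ofR (fro2 M) = \tr (adj M *m M).
Proof.
rewrite /fro2 exchange_big rmorph_sum; apply: eq_bigr => c _.
by rewrite rmorph_sum !mxE; apply: eq_bigr => i _; rewrite adjE; exact: sc_absE.
Qed.

Lemma fro2_ge0 m n (M : 'M[K]_(m, n)) : 0 <= fro2 M.
Proof. by rewrite !sumr_ge0 // => i _; rewrite sumr_ge0 // => c _; rewrite sqr_ge0. Qed.

Lemma fro2_0 m n : fro2 (0 : 'M[K]_(m, n)) = 0.
Proof. by rewrite /fro2 big1 // => i _; rewrite big1 // => c _; rewrite mxE sc_abs0 expr0n. Qed.

Lemma fro2_entry m n (M : 'M[K]_(m, n)) i c : sc_abs (M i c) ^+ 2 <= fro2 M.
Proof.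
rewrite /fro2 (bigD1 i) //= (bigD1 c) //= -addrA lerDl addr_ge0 //.
  by rewrite sumr_ge0 // => a _; rewrite sqr_ge0.
by rewrite sumr_ge0 // => a _; rewrite sumr_ge0 // => d _; rewrite sqr_ge0.
Qed.

Lemma fro2_eq0 m n (M : 'M[K]_(m, n)) : fro2 M = 0 -> M = 0.
Proof.
move=> M0; apply/matrixP => i c; rewrite mxE; apply/eqP.
rewrite -sc_abs_eq0 -sqrf_eq0; apply/eqP/le_anti.
by rewrite sqr_ge0 andbT -M0 fro2_entry.
Qed.

Lemma fro2_gt0 m n (M : 'M[K]_(m, n)) : M != 0 -> 0 < fro2 M.
Proof.
by rewrite lt_def fro2_ge0 andbT; apply: contra_neq => /fro2_eq0.
Qed.

Lemma fro2_adj m n (M : 'M[K]_(m, n)) : fro2 (adj M) = fro2 M.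
Proof.
rewrite /fro2 exchange_big; apply: eq_bigr => i _; apply: eq_bigr => c _.
by rewrite adjE sc_abs_conj.
Qed.

Lemma fro2Z m n (a : K) (M : 'M[K]_(m, n)) : fro2 (a *: M) = sc_abs a ^+ 2 * fro2 M.
Proof.
rewrite /fro2 mulr_sumr; apply: eq_bigr => i _; rewrite mulr_sumr.
by apply: eq_bigr => c _; rewrite mxE sc_absM exprMn.
Qed.

Lemma fro2N m n (M : 'M[K]_(m, n)) : fro2 (- M) = fro2 M.
Proof. by apply: eq_bigr => i _; apply: eq_bigr => c _; rewrite mxE sc_absN. Qed.

Lemma fro2_isom m n p (Q : 'M[K]_(m, n)) (M : 'M[K]_(n, p)) :
  orthonormal_cols Q -> fro2 (Q *m M) = fro2 M.
Proof.
move=> QQ; apply: (@sc_of_real_inj R b).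
by rewrite !fro2E adjM -mulmxA (mulmxA (adj Q)) QQ mul1mx.
Qed.

Lemma fro2_pythagoras m n (M N : 'M[K]_(m, n)) :
  adj M *m N = 0 -> fro2 (M + N) = fro2 M + fro2 N.
Proof.
move=> MN; apply: (@sc_of_real_inj R b); rewrite rmorphD /= !fro2E adjD.
rewrite mulmxDl !mulmxDr MN addr0.
have -> : adj N *m M = 0 by rewrite -[M]adjK -adjM MN adj0.
by rewrite add0r linearD.
Qed.

(** Q Q^* M and M - Q Q^* M are orthogonal, and the former has the norm of Q^* M. *)
Lemma fro2_proj m n p (Q : 'M[K]_(m, n)) (M : 'M[K]_(m, p)) :
  orthonormal_cols Q ->
  fro2 M = fro2 (adj Q *m M) + fro2 (M - Q *m (adj Q *m M)).
Proof.
move=> QQ; rewrite -(fro2_isom _ QQ) -fro2_pythagoras ?subrKC //.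
by rewrite adjM adjM adjK mulmxBr -!mulmxA (mulmxA (adj Q) Q) QQ mul1mx subrr.
Qed.

Lemma fro2_adj_le m n p (Q : 'M[K]_(m, n)) (M : 'M[K]_(m, p)) :
  orthonormal_cols Q -> fro2 (adj Q *m M) <= fro2 M.
Proof. by move=> QQ; rewrite [leRHS](fro2_proj M QQ) lerDl fro2_ge0. Qed.

Lemma fro2_orthonormal m n (Q : 'M[K]_(m, n)) :
  orthonormal_cols Q -> fro2 Q = n%:R.
Proof.
move=> QQ; apply: (@sc_of_real_inj R b).
by rewrite fro2E QQ mxtrace1 rmorph_nat.
Qed.

(** Minkowski's inequality, from
    |x + y|^2 <= (1 + e) |x|^2 + (1 + 1/e) |y|^2 applied entrywise with the
    e that is optimal for the whole matrices, the ratio of their norms. *)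
Lemma fro2_triangle m n (M N : 'M[K]_(m, n)) :
  Num.sqrt (fro2 (M + N)) <= Num.sqrt (fro2 M) + Num.sqrt (fro2 N).
Proof.
have [->|M0] := eqVneq M 0; first by rewrite add0r fro2_0 sqrtr0 add0r.
have [->|N0] := eqVneq N 0; first by rewrite addr0 fro2_0 sqrtr0 addr0.
set x := Num.sqrt (fro2 M); set y := Num.sqrt (fro2 N).
have x0 : 0 < x by rewrite sqrtr_gt0 fro2_gt0.
have y0 : 0 < y by rewrite sqrtr_gt0 fro2_gt0.
have Ex : fro2 M = x ^+ 2 by rewrite sqr_sqrtr ?fro2_ge0.
have Ey : fro2 N = y ^+ 2 by rewrite sqr_sqrtr ?fro2_ge0.
have le_sq : fro2 (M + N) <= (1 + y / x) * fro2 M + (1 + x / y) * fro2 N.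
  rewrite /fro2 !mulr_sumr -big_split; apply: ler_sum => i _ /=.
  rewrite !mulr_sumr -big_split; apply: ler_sum => c _ /=; rewrite mxE.
  set u := sc_abs (M i c); set v := sc_abs (N i c).
  apply: (@le_trans _ _ ((u + v) ^+ 2)).
    by rewrite ler_sqr ?nnegrE ?addr_ge0 ?sc_abs_ge0 ?sc_abs_triangle.
  rewrite -subr_ge0.
  have -> : (1 + y / x) * u ^+ 2 + (1 + x / y) * v ^+ 2 - (u + v) ^+ 2
            = (y * u - x * v) ^+ 2 / (x * y).
    by field; rewrite !gt_eqF.
  by rewrite divr_ge0 ?sqr_ge0 // mulr_ge0 // ltW.
rewrite -(@ler_pXn2r _ 2) ?nnegrE ?sqrtr_ge0 ?addr_ge0 ?(ltW x0) ?(ltW y0) //.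
rewrite sqr_sqrtr ?fro2_ge0 // (le_trans le_sq) // Ex Ey le_eqVlt.
by apply/orP; left; apply/eqP; field; rewrite !gt_eqF.
Qed.

End Adjoint.

(** * Existence of the singular value decomposition *)

Section OrthonormalSystems.
Variables (R : realType) (b : scalar_kind).
Local Notation K := (RorC R b).
Local Notation ofR := (@sc_of_real R b).

Lemma exists_kernel_vector d n (C : 'M[K]_(d, n)) :
  (d < n)%N -> exists2 x : 'cV_n, x != 0 & C *m x = 0.
Proof.
move=> ltdn; have /rowV0Pn[u /sub_kermxP uC u0] : kermx C^T != 0.
  by rewrite -mxrank_eq0 mxrank_ker mxrank_tr subn_eq0 -ltnNge (leq_ltn_trans (rank_leq_row C)).
exists u^T; first by rewrite -(inj_eq trmx_inj) trmxK trmx0.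
by apply: trmx_inj; rewrite trmx_mul trmxK uC trmx0.
Qed.

Lemma orthonormal_vector n (x : 'cV[K]_n) : fro2 x = 1 -> orthonormal_cols x.
Proof.
move=> x1; apply/matrixP => i c; rewrite !ord1 [RHS]mxE eqxx mulr1n.
have <- : ofR (fro2 x) = 1 by rewrite x1 rmorph1.
by rewrite fro2E /mxtrace big_ord1.
Qed.

Lemma normalize_vector n (x : 'cV[K]_n) :
  x != 0 -> exists2 a : K, a != 0 & orthonormal_cols (a *: x).
Proof.
move=> /fro2_gt0 x0; have sx0 : 0 < Num.sqrt (fro2 x) by rewrite sqrtr_gt0.
exists (ofR (Num.sqrt (fro2 x))^-1); first by rewrite fmorph_eq0 invr_eq0 gt_eqF.
apply: orthonormal_vector; rewrite fro2Z sc_abs_of_real real_normK ?num_real //.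
by rewrite exprVn sqr_sqrtr ?ltW // mulVf ?gt_eqF.
Qed.

Lemma orthonormal_row_mx m d e (P : 'M[K]_(m, d)) (Q : 'M[K]_(m, e)) :
  orthonormal_cols P -> orthonormal_cols Q -> adj P *m Q = 0 ->
  orthonormal_cols (row_mx P Q).
Proof.
move=> PP QQ PQ; rewrite /orthonormal_cols adj_row_mx mul_col_row.
rewrite PP QQ PQ.
by rewrite -[adj Q *m P]adjK adjM adjK PQ adj0 -scalar_mx_block.
Qed.

(** One vector at a time: the equations expressing orthogonality to the vectors
    already present are fewer than the unknowns. *)
Lemma orthonormal_complement m d (Q : 'M[K]_(m, d)) e : (d + e <= m)%N ->
  exists Q' : 'M[K]_(m, e), orthonormal_cols Q' /\ adj Q *m Q' = 0.
Proof.
elim: e => [|e IHe] le_m.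
  by exists 0; split; apply/matrixP => i; [case: i|move=> []].
have [|Q' [Q'Q' QQ']] := IHe; first by apply: leq_trans le_m; rewrite leq_add2l.
have [|x x0] := @exists_kernel_vector _ _ (col_mx (adj Q) (adj Q')).
  by rewrite -addnS.
rewrite mul_col_mx => /eqP; rewrite col_mx_eq0 => /andP[/eqP Qx /eqP Q'x].
have [a _ xx] := normalize_vector x0.
exists (row_mx (a *: x) Q'); split.
  apply: (@orthonormal_row_mx m 1 e) => //.
  by rewrite -[LHS]adjK adjM adjK -scalemxAr Q'x scaler0 adj0.
apply: etrans (@mul_mx_row _ _ _ 1 e (adj Q) (a *: x) Q') _.
by rewrite -scalemxAr Qx scaler0 QQ' row_mx0.
Qed.

Lemma unitary_completion m d (Q : 'M[K]_(m, d)) : orthonormal_cols Q ->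
  exists U : 'M[K]_m, unitary U /\
    forall i (c : 'I_d) (c' : 'I_m), c = c' :> nat -> U i c' = Q i c.
Proof.
move=> QQ; have le_dm : (d <= m)%N by rewrite -(rank_orthonormal QQ) rank_leq_row.
have [e Em] : exists e, m = (d + e)%N by exists (m - d)%N; rewrite subnKC.
move: Q QQ le_dm; rewrite Em => Q QQ _.
have [Q' [Q'Q' QQ']] := @orthonormal_complement _ _ Q e (leqnn _).
exists (row_mx Q Q'); split; first exact: orthonormal_row_mx.
move=> i c c' Ec; have -> : c' = lshift e c by apply: val_inj.
by rewrite row_mxEl.
Qed.

Lemma hermitian_eigenvalue_real n (H : 'M[K]_n) (v : 'cV[K]_n) (a : K) :
  adj H = H -> v != 0 -> H *m v = a *: v -> sc_conj a = a.
Proof.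
move=> HH v0 Hv; have E : adj v *m H *m v = sc_conj a *: (adj v *m v).
  by rewrite -{1}HH -adjM Hv adjZ scalemxAl.
move: E; rewrite -mulmxA Hv -scalemxAr => /(congr1 mxtrace).
have q0 : ofR (fro2 v) != 0 by rewrite sc_of_real_eq0 gt_eqF ?fro2_gt0.
by rewrite !mxtraceZ -fro2E => /(mulIf q0).
Qed.

Lemma mul_rdiag m n p (U : 'M[K]_(p, m)) (s : seq K) i (c : 'I_n) (c' : 'I_m) :
  c' = c :> nat -> (U *m rdiag m n s) i c = U i c' * s`_c.
Proof.
move=> Ec; rewrite mxE (bigD1 c') //= mxE Ec eqxx big1 ?addr0 // => a ac.
by rewrite mxE -Ec; case: eqP => [/val_inj E|]; rewrite ?mulr0 // E eqxx in ac *.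
Qed.

Lemma mul_rdiag0 m n p (U : 'M[K]_(p, m)) (s : seq K) i (c : 'I_n) :
  (m <= c)%N -> (U *m rdiag m n s) i c = 0.
Proof.
move=> mc; rewrite mxE big1 // => a _; rewrite mxE; case: eqP => [E|]; rewrite ?mulr0 //.
by have := ltn_ord a; rewrite E ltnNge mc.
Qed.

End OrthonormalSystems.

(** Over the reals the eigenvalue is found over the complex numbers, where it
    exists by algebraic closure, and is real since the matrix is Hermitian. *)
Lemma hermitian_eigenvector (R : realType) (b : scalar_kind) n
    (H : 'M[RorC R b]_n.+1) :
  adj H = H -> exists (l : R) (v : 'cV_n.+1),
    v != 0 /\ H *m v = sc_of_real b l *: v.
Proof.
have eigC (G : 'M[RorC R OverComplex]_n.+1) : adj G = G ->
    exists (l : R) (v : 'rV_n.+1), v != 0 /\ v *m G = sc_of_real OverComplex l *: v.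
  move=> GG; have /closed_rootP[a] : size (char_poly (G : 'M[R[i]]_n.+1)) != 1.
    by rewrite size_char_poly.
  rewrite -eigenvalue_root_char => /eigenvalueP[v vG v0].
  have v0' : adj (v : 'rV[RorC R OverComplex]_n.+1) != 0.
    by apply: contraNneq v0 => /(congr1 (@adj _ _ _ _)); rewrite adjK adj0 => ->.
  have Gv : G *m adj (v : 'rV[RorC R OverComplex]_n.+1) =
      sc_conj (a : RorC R OverComplex) *: adj (v : 'rV[RorC R OverComplex]_n.+1).
    rewrite -{1}GG -adjM.
    have -> : (v : 'rV[RorC R OverComplex]_n.+1) *m G = a *: v by exact: vG.
    by rewrite adjZ.
  have := hermitian_eigenvalue_real GG v0' Gv; rewrite sc_conjK => Ea.
  exists (complex.Re a), v; split => //; rewrite [LHS]vG; congr (_ *: _).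
  move: Ea; rewrite /=; case: (a) => x y /= [/eqP].
  by rewrite -subr_eq0 opprK -mulr2n mulrn_eq0 /= => /eqP ->.
move: H; case: b => H HH.
  have GG : adj (map_mx (@sc_of_real R OverComplex) H : 'M[RorC R OverComplex]_n.+1) =
            map_mx (@sc_of_real R OverComplex) H.
    apply/matrixP => i c; rewrite adjE !mxE sc_conj_of_real; congr sc_of_real.
    by have /matrixP/(_ i c) := HH; rewrite adjE.
  have [l [v [v0 vG]]] := eigC _ GG.
  have : eigenvalue (map_mx (@sc_of_real R OverComplex) H) (sc_of_real OverComplex l).
    by apply/eigenvalueP; exists v.
  rewrite eigenvalue_root_char -map_char_poly fmorph_root -eigenvalue_root_char.
  move=> /eigenvalueP[w wH w0]; exists l, w^T; split.
    by rewrite -(inj_eq trmx_inj) trmxK trmx0.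
  apply: trmx_inj; rewrite trmx_mul trmxK linearZ /= trmxK -[RHS]wH; congr (_ *m _).
  by apply/matrixP => i c; rewrite mxE; have /matrixP/(_ i c) := HH; rewrite adjE.
have [l [v [v0 vG]]] := eigC _ HH; exists l, (adj v); split.
  by apply: contraNneq v0 => /(congr1 (@adj _ _ _ _)); rewrite adjK adj0 => ->.
by rewrite -{1}HH -adjM vG adjZ sc_conj_of_real.
Qed.

Section SingularValueDecomposition.
Variables (R : realType) (b : scalar_kind).
Local Notation K := (RorC R b).
Local Notation ofR := (@sc_of_real R b).

(** By deflation: an eigenvector is split off, and H leaves its orthogonal
    complement, spanned by the columns of W, invariant. *)
Lemma hermitian_diagonalization n (H : 'M[K]_n) : adj H = H ->
  exists (V : 'M[K]_n) (l : 'I_n -> R), unitary V /\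
    forall i, H *m col i V = ofR (l i) *: col i V.
Proof.
elim: n H => [|n IHn] H HH.
  exists 1%:M, (fun=> 0); split; last by case.
  by rewrite /unitary /orthonormal_cols adj1 mul1mx.
have [a [x [x0 Hx]]] := hermitian_eigenvector HH.
have [z z0 vv] := normalize_vector x0; set v := z *: x in vv.
have Hv : H *m v = ofR a *: v by rewrite -scalemxAr Hx !scalerA mulrC.
have [W [WW vW]] := @orthonormal_complement _ _ _ _ v n (leqnn _).
have [|V [l [VV HV]]] := IHn (adj W *m H *m W).
  by rewrite !adjM adjK HH mulmxA.
have vHW : adj v *m H *m W = 0.
  by rewrite -{1}HH -adjM Hv adjZ -scalemxAl vW scaler0.
have vWI : v *m adj v + W *m adj W = 1%:M.
  have /unitary_mul_adj : unitary (row_mx v W : 'M[K]_(1 + n)).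
    exact: (@orthonormal_row_mx _ _ _ 1 n).
  by rewrite adj_row_mx mul_row_col.
have HW : H *m W = W *m (adj W *m H *m W).
  by rewrite -[LHS]mul1mx -vWI mulmxDl -!mulmxA (mulmxA (adj v)) vHW mulmx0 add0r.
pose B : 'M[K]_n.+1 := row_mx v (W *m V).
have colB0 : col ord0 B = v.
  have -> : ord0 = lshift n (ord0 : 'I_1) by apply: val_inj.
  by apply: etrans (@colKl _ _ 1 n _ _ _) _; rewrite col_id.
have colB j : col (lift ord0 j) B = W *m col j V.
  have -> : lift ord0 j = rshift 1 j by apply: val_inj.
  by apply: etrans (@colKr _ _ 1 n _ _ _) _; rewrite col_mul.
exists B, (fun i => if unlift ord0 i is Some j then l j else a); split.
  apply: (@orthonormal_row_mx _ _ _ 1 n) => //; first exact: orthonormal_mul.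
  by rewrite mulmxA vW mul0mx.
move=> i; case: (unliftP ord0 i) => [j ->|->]; last by rewrite colB0.
by rewrite colB mulmxA HW -mulmxA HV -scalemxAr.
Qed.

Lemma hermitian_diagonalization_sorted n (H : 'M[K]_n) : adj H = H ->
  exists (V : 'M[K]_n) (s : seq R),
    [/\ unitary V, size s = n, sorted >=%R s &
        forall i : 'I_n, H *m col i V = ofR s`_i *: col i V].
Proof.
move=> /hermitian_diagonalization[V [l [VV HV]]].
pose s := sort_tuple >=%R [tuple l i | i < n].
have /tuple_permP[p Es] : perm_eq s [tuple l i | i < n].
  by rewrite perm_sort.
exists (col_perm p V), s; split.
- apply/matrixP => i c; have /matrixP/(_ (p i) (p c)) := VV.
  rewrite [X in _ = X]mxE (inj_eq perm_inj) => E; rewrite [RHS]mxE -E !mxE.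
  by apply: eq_bigr => k _; rewrite !mxE.
- by rewrite size_tuple.
- by apply: sort_sorted => x y; exact: le_total.
- move=> i; have -> : col i (col_perm p V) = col (p i) V.
    by apply/matrixP => k c; rewrite !mxE.
  rewrite HV; congr (ofR _ *: _).
  have -> : s`_i = tnth s i by rewrite (tnth_nth 0).
  have -> : s = [tuple tnth [tuple l i | i < n] (p i) | i < n] by apply: val_inj.
  by rewrite !tnth_mktuple.
Qed.

(** With V an eigenbasis of M^* M, the columns of B = M V are orthogonal and
    their squared norms are the eigenvalues.  The d nonzero columns, normalized,
    are completed to the unitary matrix U of left singular vectors. *)
Lemma svals_exist m n (M : 'M[K]_(m, n)) : exists s, is_svals M s.
Proof.
have [|V [s [VV ss srt HV]]] := @hermitian_diagonalization_sorted _ (adj M *m M).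
  by rewrite adjM adjK.
pose B := M *m V.
have BB (i c : 'I_n) : (adj B *m B) i c = if i == c then ofR s`_c else 0.
  have -> : (adj B *m B) i c = (adj V *m (adj M *m M *m col c V)) i 0.
    rewrite adjM -col_mul -col_mul [RHS]mxE !mulmxA //.
  rewrite HV -scalemxAr -col_mul mxE mxE VV mxE.
  by case: eqP => _; rewrite ?mulr1 ?mulr0.
have BE (i : 'I_n) : fro2 (col i B) = s`_i.
  apply: (@sc_of_real_inj R b); rewrite fro2E /mxtrace big_ord1.
  have := BB i i; rewrite eqxx => <-; rewrite !mxE.
  by apply: eq_bigr => k _; rewrite !mxE.
have s_mono i c : (i <= c)%N -> (c < n)%N -> s`_c <= s`_i.
  have trs : transitive (>=%R : rel R) by move=> x y z xy yz; exact: le_trans yz xy.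
  move=> ic cn; apply: (sorted_leq_nth trs (@lexx _ R) 0 srt) => //.
    by rewrite inE ss (leq_ltn_trans ic).
  by rewrite inE ss.
have s_ge0 i : 0 <= s`_i.
  have [ltin|] := ltnP i n; last by rewrite -ss => ?; rewrite nth_default.
  by rewrite -(BE (Ordinal ltin)) fro2_ge0.
pose d := find (fun x => x == 0) s.
have le_dn : (d <= n)%N by rewrite -ss find_size.
have s_gt0 i : (i < d)%N -> 0 < s`_i.
  by move=> /(before_find 0) /negbT; rewrite lt_def s_ge0 andbT.
have s_eq0 i : (d <= i)%N -> s`_i = 0.
  move=> di; have [ltin|] := ltnP i n; last by rewrite -ss => ?; rewrite nth_default.
  apply/le_anti; rewrite s_ge0 andbT (le_trans (s_mono _ _ di ltin)) //.
  have := @nth_find _ 0 (fun x => x == 0) s.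
  by rewrite has_find -/d ss (leq_ltn_trans di ltin) => /(_ isT)/eqP ->.
pose Q : 'M[K]_(m, d) :=
  \matrix_(i, c) (B i (widen_ord le_dn c) * (ofR (Num.sqrt s`_c))^-1).
have QQ : orthonormal_cols Q.
  apply/matrixP => i c; rewrite [RHS]mxE.
  have := BB (widen_ord le_dn i) (widen_ord le_dn c).
  rewrite -(inj_eq val_inj) /= (inj_eq val_inj) mxE => E.
  rewrite mxE (eq_bigr (fun k => (adj B (widen_ord le_dn i) k * B k (widen_ord le_dn c)) *
     ((ofR (Num.sqrt s`_i))^-1 * (ofR (Num.sqrt s`_c))^-1))); last first.
    move=> k _; rewrite !adjE !mxE rmorphM /= fmorphV /= sc_conj_of_real.
    by rewrite -!mulrA; congr (_ * _); rewrite mulrCA.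
  rewrite -mulr_suml E; case: (eqVneq i c) => [->|_]; last by rewrite mul0r.
  rewrite -invfM -rmorphM /= -expr2 sqr_sqrtr // divff // fmorph_eq0 gt_eqF //.
  exact: s_gt0.
have le_dm : (d <= m)%N by rewrite -(rank_orthonormal QQ) rank_leq_row.
have [U [UU UQ]] := unitary_completion QQ.
pose t := mkseq (fun i => Num.sqrt s`_i) (minn m n).
have nth_t i : (i < minn m n)%N -> t`_i = Num.sqrt s`_i by move=> ?; rewrite nth_mkseq.
exists t; split.
- by rewrite size_mkseq.
- apply/(sortedP 0) => i; rewrite size_mkseq => lti.
  rewrite !nth_t ?(ltnW lti) //; apply: ler_wsqrtr; apply: s_mono => //.
  by apply: leq_trans lti (geq_minr _ _).
- by apply/(all_nthP 0) => i; rewrite size_mkseq => ?; rewrite nth_t ?sqrtr_ge0.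
- exists U, V; split => //.
  suff -> : U *m rdiag m n (map ofR t) = B.
    by rewrite -mulmxA unitary_mul_adj // mulmx1.
  apply/matrixP => i c.
  have col0 : (d <= c)%N -> B i c = 0.
    move=> /s_eq0 sc0; have := BE c; rewrite sc0 => /fro2_eq0/matrixP/(_ i 0).
    by rewrite !mxE.
  have [mc|cm] := leqP m c.
    by rewrite mul_rdiag0 // col0 // (leq_trans le_dm).
  rewrite (@mul_rdiag _ _ _ _ _ _ _ _ _ (Ordinal cm)) //.
  have ct : (c < minn m n)%N by rewrite leq_min cm ltn_ord.
  rewrite (nth_map 0) ?size_mkseq // nth_t //.
  have [cd|dc] := ltnP c d; last by rewrite s_eq0 // sqrtr0 rmorph0 mulr0 col0.
  rewrite (UQ i (Ordinal cd)) // mxE /= divfK.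
    by congr (B i _); apply: val_inj.
  by rewrite fmorph_eq0 sqrtr_eq0 -ltNge s_gt0.
Qed.

End SingularValueDecomposition.

(** * Courant-Fischer comparison of singular values and norms *)

Section SingularValues.
Variables (R : realType) (b : scalar_kind).
Local Notation K := (RorC R b).
Local Notation ofR := (@sc_of_real R b).

Lemma sum_ord_support (T : nmodType) p N (g : nat -> T) :
  (p <= N)%N -> (forall i, (p <= i)%N -> g i = 0) ->
  \sum_(i < N) g i = \sum_(i < p) g i.
Proof.
move=> pN g0; rewrite (big_ord_widen N g pN) [LHS](bigID (fun i : 'I_N => i < p)%N) /=.
by rewrite [X in _ + X]big1 ?addr0 // => i; rewrite -leqNgt => /g0.
Qed.

Lemma entryE m n (M : 'M[K]_(m, n)) (i : 'I_m) (c : 'I_n) : entry M i c = M i c.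
Proof. by rewrite /entry !valK. Qed.

Lemma entry_vec n (x : 'cV[K]_n) (c : 'I_n) : entry x c 0 = x c 0.
Proof. exact: (entryE x c (0 : 'I_1)). Qed.

Lemma entry_row_out m n (M : 'M[K]_(m, n)) i c : (m <= i)%N -> entry M i c = 0.
Proof. by move=> mi; rewrite /entry insubN // -leqNgt. Qed.

Lemma entry_col_out m n (M : 'M[K]_(m, n)) i c : (n <= c)%N -> entry M i c = 0.
Proof.
by move=> nc; rewrite /entry; case: insub => // i'; rewrite insubN // -leqNgt.
Qed.

Lemma fro2_vec n (x : 'cV[K]_n) : fro2 x = \sum_(c < n) sc_abs (x c 0) ^+ 2.
Proof. by apply: eq_bigr => c _; rewrite big_ord1. Qed.

Lemma fro2_col m n (M : 'M[K]_(m, n)) : fro2 M = \sum_(c < n) fro2 (col c M).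
Proof.
rewrite /fro2 exchange_big; apply: eq_bigr => c _; apply: eq_bigr => i _.
by rewrite big_ord1 mxE.
Qed.

Lemma fro2_rdiag_mul m n (s : seq R) (y : 'cV[K]_n) : size s = minn m n ->
  fro2 (rdiag m n (map ofR s) *m y) = \sum_(c < n) s`_c ^+ 2 * sc_abs (y c 0) ^+ 2.
Proof.
move=> ss; pose g c := s`_c ^+ 2 * sc_abs (entry y c 0) ^+ 2.
have g0 i : (minn m n <= i)%N -> g i = 0.
  by move=> ?; rewrite /g nth_default ?ss // expr0n mul0r.
transitivity (\sum_(i < m) g i); last first.
  rewrite (sum_ord_support (geq_minl m n) g0) -(sum_ord_support (geq_minr m n) g0).
  by apply: eq_bigr => c _; rewrite /g entry_vec.
rewrite fro2_vec; apply: eq_bigr => i _; rewrite mxE.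
have [mi|im] := leqP n i.
  rewrite big1 => [|c _]; first by rewrite sc_abs0 /g entry_row_out // sc_abs0 expr0n mulr0.
  by rewrite mxE; case: eqP (ltn_ord c) => [<-|_]; rewrite ?mul0r // ltnNge mi.
rewrite (bigD1 (Ordinal im)) //= big1 => [|c ci]; last first.
  rewrite mxE; case: ifP => [/eqP Ei|_]; last by rewrite mul0r.
  by case/eqP: ci; apply: val_inj; rewrite /= -Ei.
rewrite addr0 mxE eqxx (nth_map 0) ?ss ?leq_min ?ltn_ord //.
rewrite sc_absM sc_abs_of_real exprMn real_normK ?num_real // /g.
by rewrite -(entry_vec y (Ordinal im)).
Qed.

(** In the coordinates of a right singular basis |Mx|^2 is diagonal: all that
    the Courant-Fischer bounds need from a decomposition. *)
Lemma svals_quadratic_form m n (M : 'M[K]_(m, n)) s : is_svals M s ->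
  exists2 V : 'M[K]_n, unitary V &
    forall x : 'cV_n, fro2 (M *m x) =
      \sum_(c < n) s`_c ^+ 2 * sc_abs ((adj V *m x) c 0) ^+ 2.
Proof.
case=> ss _ _ [U [V [UU VV ->]]]; exists V => // x.
by rewrite -!mulmxA fro2_isom // fro2_rdiag_mul.
Qed.

Lemma svals_ge0 m n (M : 'M[K]_(m, n)) s i : is_svals M s -> 0 <= s`_i.
Proof.
case=> _ _ /(all_nthP 0) s0 _; have [/s0//|?] := ltnP i (size s).
by rewrite nth_default.
Qed.

Lemma svals_mono m n (M : 'M[K]_(m, n)) s i c : is_svals M s ->
  (i <= c)%N -> s`_c <= s`_i.
Proof.
move=> sM; have s0 := svals_ge0 _ sM; case: (sM) => _ srt _ _ ic.
have [cs|?] := ltnP c (size s); last by rewrite (nth_default _ (_ : (size s <= c)%N)).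
have trs : transitive (>=%R : rel R) by move=> x y z xy yz; exact: le_trans yz xy.
apply: (sorted_leq_nth trs (@lexx _ R) 0 srt) => //.
by rewrite inE (leq_ltn_trans ic).
Qed.

(** The bound N is free so that sums over lists of different lengths can be compared. *)
Lemma fro2_svals m n (M : 'M[K]_(m, n)) s N : is_svals M s -> (minn m n <= N)%N ->
  fro2 M = \sum_(i < N) s`_i ^+ 2.
Proof.
move=> sM; case: (sM) => ss _ _ _ leN; have [V VV MV] := svals_quadratic_form sM.
have g0 i : (minn m n <= i)%N -> s`_i ^+ 2 = 0.
  by move=> ?; rewrite nth_default ?ss // expr0n.
rewrite (sum_ord_support leN g0) -(sum_ord_support (geq_minr m n) g0).
rewrite -fro2_adj -(fro2_isom (adj M) (unitary_adj VV)) -adjM fro2_adj fro2_col.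
apply: eq_bigr => c _; rewrite col_mul MV -col_mul VV (bigD1 c) //= big1 => [|a ac].
  by rewrite !mxE eqxx -(rmorph1 ofR) sc_abs_of_real normr1 expr1n mulr1 addr0.
by rewrite !mxE (negPf ac) sc_abs0 expr0n mulr0.
Qed.

Lemma mul_row_block lo d m n (N : 'M[K]_(m, n)) (x : 'cV[K]_n) (a : 'I_d) (c : 'I_m) :
  c = (lo + a)%N :> nat ->
  (\matrix_(a < d, c < n) entry N (lo + a) c *m x) a 0 = (N *m x) c 0.
Proof.
by move=> Ec; rewrite !mxE; apply: eq_bigr => k _; rewrite mxE -Ec entryE.
Qed.

(** The two halves of the Courant-Fischer principle, a subspace being given by
    the linear equations defining it: i equations for the first, all but i + 1
    for the second. *)
Lemma courant_fischer_upper m n (M : 'M[K]_(m, n)) s i : is_svals M s ->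
  exists C : 'M[K]_(i, n), forall x : 'cV_n, C *m x = 0 ->
    fro2 (M *m x) <= s`_i ^+ 2 * fro2 x.
Proof.
move=> sM; have s0 c := svals_ge0 c sM; have [V VV MV] := svals_quadratic_form sM.
exists (\matrix_(a < i, c < n) entry (adj V) (0 + a) c) => x Cx.
rewrite MV -(fro2_isom x (unitary_adj VV)) fro2_vec mulr_sumr; apply: ler_sum => c _.
have [ic|ci] := leqP i c.
  by rewrite ler_wpM2r ?sqr_ge0 // ler_sqr ?nnegrE // (svals_mono sM).
have := @mul_row_block 0 _ _ _ (adj V) x (Ordinal ci) c (erefl _).
by rewrite Cx mxE => <-; rewrite sc_abs0 expr0n !mulr0.
Qed.

Lemma courant_fischer_lower m n (M : 'M[K]_(m, n)) s i : is_svals M s ->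
  exists C : 'M[K]_(n - i.+1, n), forall x : 'cV_n, C *m x = 0 ->
    s`_i ^+ 2 * fro2 x <= fro2 (M *m x).
Proof.
move=> sM; have s0 c := svals_ge0 c sM; have [V VV MV] := svals_quadratic_form sM.
exists (\matrix_(a < n - i.+1, c < n) entry (adj V) (i.+1 + a) c) => x Cx.
rewrite MV -(fro2_isom x (unitary_adj VV)) fro2_vec mulr_sumr; apply: ler_sum => c _.
have [ci|ic] := leqP c i.
  by rewrite ler_wpM2r ?sqr_ge0 // ler_sqr ?nnegrE // (svals_mono sM).
have ltc : (c - i.+1 < n - i.+1)%N by rewrite ltn_sub2r // (leq_ltn_trans ic).
have := @mul_row_block i.+1 _ _ _ (adj V) x (Ordinal ltc) c.
by rewrite /= subnKC // => /(_ (erefl _)); rewrite Cx mxE => <-; rewrite sc_abs0 expr0n !mulr0.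
Qed.

(** A linear map F that, up to the factor a, does not decrease the ratio
    |Mx| / |x| when passing to |M'Fx| / |Fx| orders all the singular values:
    a vector common to the subspaces of the two Courant-Fischer halves exists
    for dimension reasons.  Indices past the end of s or s' read 0, which agrees
    with both halves, so matrices of different shapes can be compared. *)
Lemma svals_comparison m n m' n' (M : 'M[K]_(m, n)) (M' : 'M[K]_(m', n'))
    (F : 'M[K]_(n', n)) (a : R) s s' :
  is_svals M s -> is_svals M' s' -> 0 <= a ->
  (forall x : 'cV_n, fro2 (M *m x) * fro2 (F *m x) <=
                     a ^+ 2 * fro2 (M' *m (F *m x)) * fro2 x) ->
  (forall x : 'cV_n, F *m x = 0 -> M *m x = 0) ->
  forall i, s`_i <= a * s'`_i.
Proof.
move=> sM sM' a0 le_ratio kerF i.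
have [-> |si0] := eqVneq s`_i 0; first by rewrite mulr_ge0 // (svals_ge0 _ sM').
have s_gt0 : 0 < s`_i by rewrite lt_def si0 (svals_ge0 _ sM).
have lt_in : (i < n)%N.
  rewrite ltnNge; apply: contra si0 => ni; case: sM => ss _ _ _.
  by rewrite nth_default // ss (leq_trans (geq_minr _ _)).
have [C lowM] := courant_fischer_lower i sM.
have [C' upM'] := courant_fischer_upper i sM'.
have [|x x0] := @exists_kernel_vector _ _ _ _ (col_mx C (C' *m F)).
  by rewrite -ltn_subRL subKn // ltnW.
rewrite mul_col_mx => /eqP; rewrite col_mx_eq0 => /andP[/eqP Cx /eqP C'Fx].
have {}lowM := lowM _ Cx; have {}upM' : fro2 (M' *m (F *m x)) <= s'`_i ^+ 2 * fro2 (F *m x).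
  by apply: upM'; rewrite mulmxA.
have x_gt0 := fro2_gt0 x0.
have Fx0 : F *m x != 0.
  apply/eqP => /kerF Mx0; move: lowM; rewrite Mx0 fro2_0 leNgt mulr_gt0 //.
  by rewrite exprn_gt0.
have Fx_gt0 := fro2_gt0 Fx0.
rewrite -(@ler_pXn2r _ 2) ?nnegrE ?mulr_ge0 ?(svals_ge0 _ sM') ?(ltW s_gt0) //.
rewrite -(ler_pM2r (mulr_gt0 x_gt0 Fx_gt0)) mulrA.
apply: (le_trans (y := fro2 (M *m x) * fro2 (F *m x))).
  by rewrite ler_wpM2r // ltW.
apply: (le_trans (le_ratio x)).
have -> : (a * s'`_i) ^+ 2 * (fro2 x * fro2 (F *m x)) =
          a ^+ 2 * (s'`_i ^+ 2 * fro2 (F *m x)) * fro2 x by ring.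
by rewrite ler_wpM2r ?(ltW x_gt0) // ler_wpM2l // sqr_ge0.
Qed.

Lemma svals_unique m n (M : 'M[K]_(m, n)) s s' :
  is_svals M s -> is_svals M s' -> s = s'.
Proof.
have le (u v : seq R) : is_svals M u -> is_svals M v -> forall i, u`_i <= v`_i.
  move=> Mu Mv i; rewrite -[leRHS]mul1r.
  apply: (@svals_comparison _ _ _ _ M M 1%:M 1 _ _ Mu Mv) => // x; rewrite mul1mx.
    by rewrite expr1n mul1r.
  by move=> ->; rewrite mulmx0.
move=> Ms Ms'; apply: (@eq_from_nth _ 0) => [|i _].
  by case: Ms Ms' => -> _ _ _ [->].
by apply/le_anti; rewrite !le.
Qed.

Lemma svalsP m n (M : 'M[K]_(m, n)) : is_svals M (svals M).
Proof.
by rewrite /svals; case: xgetP => [s ->//|]; have [s Ms] := svals_exist M => /(_ s Ms).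
Qed.

Lemma svalsE m n (M : 'M[K]_(m, n)) s : is_svals M s -> svals M = s.
Proof. exact: svals_unique (svalsP M). Qed.

Lemma size_svals m n (M : 'M[K]_(m, n)) : size (svals M) = minn m n.
Proof. by case: (svalsP M). Qed.

Lemma mxnorm_frobenius m n (M : 'M[K]_(m, n)) :
  mxnorm Frobenius M = Num.sqrt (fro2 M).
Proof. by []. Qed.

Lemma mxnorm_ge0 nu m n (M : 'M[K]_(m, n)) : 0 <= mxnorm nu M.
Proof. by case: nu => /=; rewrite ?(svals_ge0 _ (svalsP M)) ?sqrtr_ge0. Qed.

(** Both norms are monotone functions of the singular values, so the comparison
    of singular values carries over to them; multiplication by a bounded matrix
    on either side is the instance F = 1 or F = G below. *)
Lemma mxnorm_comparison nu m n m' n' (M : 'M[K]_(m, n)) (M' : 'M[K]_(m', n'))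
    (F : 'M[K]_(n', n)) (a : R) :
  0 <= a ->
  (forall x : 'cV_n, fro2 (M *m x) * fro2 (F *m x) <=
                     a ^+ 2 * fro2 (M' *m (F *m x)) * fro2 x) ->
  (forall x : 'cV_n, F *m x = 0 -> M *m x = 0) ->
  mxnorm nu M <= a * mxnorm nu M'.
Proof.
move=> a0 le_ratio kerF.
have le_s := svals_comparison (svalsP M) (svalsP M') a0 le_ratio kerF.
case: nu; first exact: le_s.
rewrite !mxnorm_frobenius -{1}(ger0_norm a0) -sqrtr_sqr -sqrtrM ?sqr_ge0 //.
apply: ler_wsqrtr.
have leN := leq_maxl (minn m n) (minn m' n'); have leN' := leq_maxr (minn m n) (minn m' n').
rewrite (fro2_svals (svalsP M) leN) (fro2_svals (svalsP M') leN') mulr_sumr.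
apply: ler_sum => i _; rewrite -exprMn ler_sqr ?nnegrE ?mulr_ge0 //;
  exact: svals_ge0 (svalsP _).
Qed.

Lemma mxnorm_mulmx_left nu m n p (C : 'M[K]_(p, m)) (M : 'M[K]_(m, n)) (a : R) :
  0 <= a -> (forall x : 'cV_m, fro2 (C *m x) <= a ^+ 2 * fro2 x) ->
  mxnorm nu (C *m M) <= a * mxnorm nu M.
Proof.
move=> a0 leC; apply: (@mxnorm_comparison _ _ _ _ _ _ _ 1%:M) => // x; rewrite mul1mx.
  by rewrite ler_wpM2r ?fro2_ge0 // -mulmxA.
by move=> ->; rewrite mulmx0.
Qed.

Lemma mxnorm_mulmx_right nu m n p (M : 'M[K]_(m, n)) (G : 'M[K]_(n, p)) (a : R) :
  0 <= a -> (forall x : 'cV_p, fro2 (G *m x) <= a ^+ 2 * fro2 x) ->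
  mxnorm nu (M *m G) <= a * mxnorm nu M.
Proof.
move=> a0 leG; apply: (@mxnorm_comparison _ _ _ _ _ _ _ G) => // x; rewrite -mulmxA.
  by rewrite mulrC mulrAC ler_wpM2r ?fro2_ge0.
by move=> ->; rewrite mulmx0.
Qed.

Lemma spectral_bound m n (M : 'M[K]_(m, n)) (x : 'cV[K]_n) :
  fro2 (M *m x) <= mxnorm Spectral M ^+ 2 * fro2 x.
Proof.
have [C upM] := courant_fischer_upper 0 (svalsP M).
by apply: upM; apply/matrixP => -[].
Qed.

Lemma spectral_le m n (M : 'M[K]_(m, n)) (a : R) : 0 <= a ->
  (forall x : 'cV_n, fro2 (M *m x) <= a ^+ 2 * fro2 x) -> mxnorm Spectral M <= a.
Proof.
move=> a0 leM; have [->//|s0] := eqVneq (mxnorm Spectral M) 0.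
have n_gt0 : (0 < n)%N.
  rewrite lt0n; apply: contra s0 => /eqP n0.
  by rewrite /= nth_default // size_svals n0 minn0.
have [C lowM] := courant_fischer_lower 0 (svalsP M).
have [|x x0 Cx] := @exists_kernel_vector _ _ _ _ C; first by rewrite subn1 prednK.
rewrite -(@ler_pXn2r _ 2) ?nnegrE ?mxnorm_ge0 // -(ler_pM2r (fro2_gt0 x0)).
exact: le_trans (lowM _ Cx) (leM x).
Qed.

Lemma mxnorm_triangle nu m n (M N : 'M[K]_(m, n)) :
  mxnorm nu (M + N) <= mxnorm nu M + mxnorm nu N.
Proof.
case: nu; last exact: fro2_triangle.
apply: spectral_le => [|x]; first by rewrite addr_ge0 ?mxnorm_ge0.
have sx := sqrtr_ge0 (fro2 x).
have bound (P : 'M[K]_(m, n)) :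
    Num.sqrt (fro2 (P *m x)) <= mxnorm Spectral P * Num.sqrt (fro2 x).
  rewrite -[X in X * _]ger0_norm ?mxnorm_ge0 // -sqrtr_sqr -sqrtrM ?sqr_ge0 //.
  by rewrite ler_wsqrtr // spectral_bound.
have := le_trans (fro2_triangle (M *m x) (N *m x)) (lerD (bound M) (bound N)).
rewrite -mulrDl -mulmxDl -(@ler_pXn2r _ 2) ?nnegrE ?sqrtr_ge0 //; last first.
  by rewrite mulr_ge0 // addr_ge0 // mxnorm_ge0.
by rewrite exprMn !sqr_sqrtr ?fro2_ge0.
Qed.

Lemma mxnormN nu m n (M : 'M[K]_(m, n)) : mxnorm nu (- M) = mxnorm nu M.
Proof.
apply/le_anti/andP; split; rewrite -[leRHS]mul1r;
  apply: (@mxnorm_comparison _ _ _ _ _ _ _ 1%:M) => // x;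
  rewrite mul1mx ?expr1n ?mul1r ?mulNmx ?fro2N // => ->; rewrite mulmx0 ?oppr0 //.
Qed.

Lemma adj_rdiag m n (s : seq R) : adj (rdiag m n (map ofR s)) = rdiag n m (map ofR s).
Proof.
apply/matrixP => i c; rewrite adjE !mxE eq_sym; case: eqP => [->|_]; last by rewrite rmorph0.
have [lts|ges] := ltnP c (size s); first by rewrite (nth_map 0) // sc_conj_of_real.
by rewrite nth_default ?size_map // rmorph0.
Qed.

Lemma mxnorm_adj nu m n (M : 'M[K]_(m, n)) : mxnorm nu (adj M) = mxnorm nu M.
Proof.
case: nu; last by rewrite !mxnorm_frobenius fro2_adj.
congr (_`_0); apply: svalsE.
have [ss srt s0 [U [V [UU VV EM]]]] := svalsP M; split => //; first by rewrite minnC.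
by exists V, U; split => //; rewrite [in LHS]EM !adjM adjK adj_rdiag mulmxA.
Qed.

Lemma spectral_entry m n (M : 'M[K]_(m, n)) i c :
  sc_abs (M i c) <= mxnorm Spectral M.
Proof.
rewrite -(@ler_pXn2r _ 2) ?nnegrE ?sc_abs_ge0 ?mxnorm_ge0 //.
have := spectral_bound M (delta_mx c 0); rewrite -colE => le_c.
have -> : sc_abs (M i c) = sc_abs (col c M i 0) by rewrite mxE.
apply: (le_trans (fro2_entry _ i 0)); apply: (le_trans le_c).
rewrite fro2_vec (bigD1 c) //= big1 => [|a ac].
  by rewrite mxE !eqxx -(rmorph1 ofR) sc_abs_of_real normr1 expr1n addr0 mulr1.
by rewrite mxE (negPf ac) sc_abs0 expr0n.
Qed.

End SingularValues.

(** * Subspaces, orthonormal bases and sines of principal angles *)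

Section Subspaces.
Variables (R : realType) (b : scalar_kind).
Local Notation K := (RorC R b).
Local Notation ofR := (@sc_of_real R b).

Lemma memv_mximage m n (M : 'M[K]_(m, n)) (S : {vspace 'cV[K]_n}) (v : 'cV[K]_m) :
  (v \in mximage M S) <-> exists2 x, x \in S & v = M *m x.
Proof.
split=> [/memv_imgP[x xS ->]|[x xS ->]]; first by exists x => //; rewrite lfunE.
by apply/memv_imgP; exists x => //; rewrite lfunE.
Qed.

Lemma memv_colrange m n (M : 'M[K]_(m, n)) (v : 'cV[K]_m) :
  (v \in colrange M) <-> exists x, v = M *m x.
Proof.
rewrite /colrange memv_mximage; split=> [[x _ ->]|[x ->]]; first by exists x.
by exists x; rewrite ?memvf.
Qed.

Lemma colrange_subP m n p (M : 'M[K]_(m, n)) (Q : 'M[K]_(m, p)) :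
  (colrange M <= colrange Q)%VS <-> exists C, M = Q *m C.
Proof.
split=> [/subvP MQ|[C ->]]; last first.
  by apply/subvP => v /memv_colrange[x ->]; apply/memv_colrange; exists (C *m x); rewrite mulmxA.
have /fin_all_exists[f fE] : forall c : 'I_n, exists x, col c M = Q *m x.
  move=> c; apply/memv_colrange/MQ/memv_colrange; exists (delta_mx c 0).
  by rewrite colE.
exists (\matrix_(i, c) f c i 0); apply/matrixP => i c.
have /matrixP/(_ i 0) := fE c; rewrite !mxE => ->.
by apply: eq_bigr => k _; rewrite mxE.
Qed.

Lemma mximage_colrange m n p (M : 'M[K]_(m, n)) (Q : 'M[K]_(n, p)) :
  mximage M (colrange Q) = colrange (M *m Q).
Proof.
apply/vspaceP => v; apply/idP/idP.
  move=> /memv_mximage[x /memv_colrange[y ->] ->]; apply/memv_colrange.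
  by exists y; rewrite mulmxA.
move=> /memv_colrange[y ->]; apply/memv_mximage; exists (Q *m y).
  by apply/memv_colrange; exists y.
by rewrite mulmxA.
Qed.

Lemma dim_colrange_injective m n (M : 'M[K]_(m, n)) :
  (forall x : 'cV_n, M *m x = 0 -> x = 0) -> \dim (colrange M) = n.
Proof.
move=> injM; rewrite /colrange /mximage limg_dim_eq; last first.
  apply/eqP; rewrite -subv0; apply/subvP => x; rewrite memv_cap memv_ker memvf /=.
  by rewrite lfunE memv0 => /eqP/injM ->.
by rewrite dimvf /dim /= muln1.
Qed.

Lemma dim_colrange m n (M : 'M[K]_(m, n)) : \dim (colrange M) = \rank M.
Proof.
have -> : colrange M = colrange (col_base M).
  apply/eqP; rewrite eqEsubv; apply/andP; split; apply/colrange_subP.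
    by exists (row_base M); rewrite mulmx_base.
  exists (pinvmx (row_base M)).
  have /(congr1 (mulmx^~ (pinvmx (row_base M)))) := mulmx_base M.
  by rewrite -mulmxA mulmxVp ?mulmx1 // row_base_free.
rewrite dim_colrange_injective // => x Mx0.
by rewrite -[x]mul1mx -(mulVpmx (col_base_full M)) -mulmxA Mx0 mulmx0.
Qed.

Lemma first_colsE l m n (M : 'M[K]_(m, n)) i (c : 'I_l) (c' : 'I_n) :
  c = c' :> nat -> first_cols l M i c = M i c'.
Proof. by move=> Ec; rewrite mxE Ec entryE. Qed.

Lemma first_cols_widen l m n (ln : (l <= n)%N) (M : 'M[K]_(m, n)) i c :
  first_cols l M i c = M i (widen_ord ln c).
Proof. exact: first_colsE. Qed.

Lemma orthonormal_first_cols l m n (Q : 'M[K]_(m, n)) : (l <= n)%N ->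
  orthonormal_cols Q -> orthonormal_cols (first_cols l Q).
Proof.
move=> ln /matrixP QQ; apply/matrixP => i c.
have := QQ (widen_ord ln i) (widen_ord ln c); rewrite !mxE -(inj_eq val_inj) /= => <-.
by apply: eq_bigr => k _; rewrite !adjE !first_cols_widen.
Qed.

Lemma is_onb_dim N d (S : {vspace 'cV[K]_N}) (Q : 'M[K]_(N, d)) : is_onb S Q -> d = \dim S.
Proof. by case=> QQ <-; rewrite dim_colrange rank_orthonormal. Qed.

(** The columns of a tall matrix lie in the span of its first left singular
    vectors. *)
Lemma orthonormal_factorization m n (M : 'M[K]_(m, n)) : (n <= m)%N ->
  exists (Q : 'M[K]_(m, n)) (C : 'M[K]_n), orthonormal_cols Q /\ M = Q *m C.
Proof.
move=> nm; have [ss _ _ [U [V [UU VV EM]]]] := svalsP M.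
exists (first_cols n U), (rdiag n n (map ofR (svals M)) *m adj V); split.
  exact: orthonormal_first_cols.
rewrite {1}EM mulmxA; congr (_ *m _); apply/matrixP => i c.
rewrite (@mul_rdiag _ _ _ _ _ _ _ _ _ (widen_ord nm c)) //.
by rewrite (@mul_rdiag _ _ _ _ _ _ _ _ _ c) // (first_cols_widen nm).
Qed.

Lemma onb_mxP N (S : {vspace 'cV[K]_N}) : is_onb S (onb_mx S).
Proof.
rewrite /onb_mx; case: xgetP => [Q -> //|noQ]; exfalso.
pose B : 'M[K]_(N, \dim S) := \matrix_(i, c) (vbasis S)`_c i 0.
have colB c : col c B = (vbasis S)`_c by apply/matrixP => i k; rewrite !mxE ord1.
have SB : colrange B = S.
  apply/vspaceP => v; apply/idP/idP => [/memv_colrange[x ->]|vS].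
    have -> : B *m x = \sum_c x c 0 *: (vbasis S)`_c.
      apply/matrixP => i k; rewrite ord1 mxE summxE; apply: eq_bigr => c _.
      by rewrite !mxE mulrC.
    apply: rpred_sum => c _; apply/rpredZ/vbasis_mem/mem_nth.
    by rewrite size_tuple.
  apply/memv_colrange; exists (\col_c coord (vbasis S) c v).
  rewrite {1}(coord_vbasis vS); apply/matrixP => i k; rewrite ord1 mxE summxE.
  by apply: eq_bigr => c _; rewrite !mxE mulrC.
have leN : (\dim S <= N)%N.
  by apply: leq_trans (dimvS (subvf S)) _; rewrite dimvf /dim /= muln1.
have [Q [C [QQ EB]]] := orthonormal_factorization B leN.
apply: (noQ Q); split => //; apply/eqP; rewrite eq_sym eqEdim.
rewrite dim_colrange rank_orthonormal // leqnn andbT.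
suff : (colrange B <= colrange Q)%VS by rewrite SB.
by apply/colrange_subP; exists C.
Qed.

Lemma onb_projK N d n (S : {vspace 'cV[K]_N}) (Q : 'M[K]_(N, d)) (B : 'M[K]_(N, n)) :
  is_onb S Q -> (colrange B <= S)%VS -> Q *m (adj Q *m B) = B.
Proof.
by case=> QQ <- /colrange_subP[C ->]; rewrite (mulmxA (adj Q)) QQ mul1mx.
Qed.

Lemma onb_proj_unique N d d' (S : {vspace 'cV[K]_N}) (Q : 'M[K]_(N, d))
    (Q' : 'M[K]_(N, d')) :
  is_onb S Q -> is_onb S Q' -> Q *m adj Q = Q' *m adj Q'.
Proof.
move=> SQ SQ'; have EQ : Q *m (adj Q *m Q') = Q'.
  by apply: onb_projK SQ _; case: SQ' => _ ->; exact: subvv.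
have EQ' : Q' *m (adj Q' *m Q) = Q.
  by apply: onb_projK SQ' _; case: SQ => _ ->; exact: subvv.
have -> : adj Q = adj Q *m Q' *m adj Q' by rewrite -{1}EQ' !adjM adjK.
by rewrite mulmxA EQ.
Qed.

End Subspaces.

Section Sines.
Variables (R : realType) (b : scalar_kind).
Local Notation K := (RorC R b).
Local Notation ofR := (@sc_of_real R b).

Lemma size_Theta N (S T : {vspace 'cV[K]_N}) :
  size (Theta S T) = minn (\dim S) (\dim T).
Proof. by rewrite size_map size_svals. Qed.

Lemma svals_cross_le1 N d e (P : 'M[K]_(N, d)) (Q : 'M[K]_(N, e)) i :
  orthonormal_cols P -> orthonormal_cols Q -> 0 <= (svals (adj P *m Q))`_i <= 1.
Proof.
move=> PP QQ; have sM := svalsP (adj P *m Q); rewrite (svals_ge0 _ sM) /=.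
apply: le_trans (svals_mono sM (leq0n i)) _; apply: spectral_le => // x.
by rewrite expr1n mul1r -mulmxA (le_trans (fro2_adj_le _ PP)) // fro2_isom.
Qed.

(** The projection Q Q^* depends only on the subspace, and two bases of T differ
    by an isometry; hence the norm does not depend on the chosen bases. *)
Lemma mxnorm_sub_proj_le nu N d d' e e' (S T : {vspace 'cV[K]_N})
    (Q : 'M[K]_(N, d)) (Q' : 'M[K]_(N, d')) (P : 'M[K]_(N, e)) (P' : 'M[K]_(N, e')) :
  is_onb S Q -> is_onb S Q' -> is_onb T P -> is_onb T P' ->
  mxnorm nu (P - Q *m (adj Q *m P)) <= mxnorm nu (P' - Q' *m (adj Q' *m P')).
Proof.
move=> SQ SQ' TP TP'.
have EP : P' *m (adj P' *m P) = P.
  by apply: onb_projK TP' _; case: TP => _ ->; exact: subvv.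
have -> : P - Q *m (adj Q *m P) = (P' - Q' *m (adj Q' *m P')) *m (adj P' *m P).
  by rewrite mulmxBl EP !mulmxA (onb_proj_unique SQ SQ') -!mulmxA EP.
rewrite -[leRHS]mul1r; apply: mxnorm_mulmx_right => // x; rewrite expr1n mul1r.
case: TP TP' => PP _ [P'P' _].
by rewrite -mulmxA (le_trans (fro2_adj_le _ P'P')) // fro2_isom.
Qed.

Lemma fro2_rdiag N (l : seq R) :
  fro2 (@rdiag R OverReal N N l) = \sum_(i < N) l`_i ^+ 2.
Proof.
apply: eq_bigr => i _; rewrite (bigD1 i) //= big1 => [|c ci].
  by rewrite mxE eqxx addr0 /= real_normK ?num_real.
have -> : @rdiag R OverReal N N l i c = 0.
  by rewrite mxE eq_sym val_eqE (negPf ci).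
by rewrite normr0 expr0n.
Qed.

(** The sines of the principal angles are, in reverse order, the
    singular values of (1 - QQ^* ) P, because (1 - QQ^* ) P and Q^* P together are an isometry. *)
Lemma mxnorm_sin_Theta nu N d e (S T : {vspace 'cV[K]_N})
    (Q : 'M[K]_(N, d)) (P : 'M[K]_(N, e)) :
  is_onb S Q -> is_onb T P -> (e <= d)%N ->
  mxnorm nu (sin_Theta S T) = mxnorm nu (P - Q *m (adj Q *m P)).
Proof.
move=> SQ TP ed; have SQ' := onb_mxP S; have TP' := onb_mxP T.
have -> : mxnorm nu (P - Q *m (adj Q *m P)) =
    mxnorm nu (onb_mx T - onb_mx S *m (adj (onb_mx S) *m onb_mx T)).
  by apply/le_anti; rewrite !(@mxnorm_sub_proj_le _ _ _ _ _ _ S T).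
rewrite (is_onb_dim SQ) (is_onb_dim TP) in ed.
move: SQ' TP' => {Q P SQ TP} [QQ _] [PP _].
have size_sin := size_Theta S T; rewrite (minn_idPr ed) in size_sin.
set Q := onb_mx S in QQ *; set P := onb_mx T in PP *.
have sM := svalsP (adj Q *m P).
set s := svals (adj Q *m P) in sM; have s01 i : 0 <= s`_i <= 1 by apply: svals_cross_le1.
have sinE i : (i < \dim T)%N -> (map sin (Theta S T))`_i ^+ 2 = 1 - s`_i ^+ 2.
  move=> ltT; have /andP[s0 s1] := s01 i.
  rewrite (nth_map 0) ?size_sin // (nth_map 0) ?size_svals ?(minn_idPr ed) //.
  rewrite sin_acos ?s1 ?andbT ?(le_trans _ s0) ?oppr_le0 //.
  by rewrite sqr_sqrtr // subr_ge0 expr_le1.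
have sin_ge0 i : 0 <= (map sin (Theta S T))`_i.
  have [ltT|?] := ltnP i (\dim T); last by rewrite nth_default // size_map size_sin.
  have /andP[s0 s1] := s01 i.
  rewrite (nth_map 0) ?size_sin // (nth_map 0) ?size_svals ?(minn_idPr ed) //.
  by rewrite sin_acos ?s1 ?andbT ?(le_trans _ s0) ?oppr_le0 ?sqrtr_ge0.
have split_norm (x : 'cV[K]_(\dim T)) :
    fro2 ((P - Q *m (adj Q *m P)) *m x) = fro2 x - fro2 (adj Q *m P *m x).
  rewrite -(fro2_isom x PP) (fro2_proj (P *m x) QQ) mulmxBl -!mulmxA.
  by rewrite addrAC subrr add0r.
case: nu; last first.
  rewrite !mxnorm_frobenius fro2_rdiag; congr Num.sqrt.
  have := fro2_proj P QQ; rewrite fro2_orthonormal // => /eqP.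
  rewrite addrC -subr_eq => /eqP <-; rewrite (fro2_svals sM (geq_minr _ _)).
  rewrite size_sin (eq_bigr (fun i : 'I_(\dim T) => 1 - s`_i ^+ 2)) => [|i _]; last exact: sinE.
  by rewrite sumrB sumr_const card_ord.
have [T0|T_gt0] := posnP (\dim T).
  by rewrite /= !nth_default ?size_svals ?size_sin ?minnn ?T0 ?minn0.
set l := (\dim T).-1; have lT : (l < \dim T)%N by rewrite prednK.
apply/le_anti/andP; split; apply: spectral_le; rewrite ?mxnorm_ge0 // => x.
  (* A vector attaining the smallest cosine attains the largest sine. *)
  have [C upM] := courant_fischer_upper l sM.
  have [y y0 Cy] := exists_kernel_vector C lT.
  have le_l : 1 - s`_l ^+ 2 <= mxnorm Spectral (P - Q *m (adj Q *m P)) ^+ 2.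
    rewrite -(ler_pM2r (fro2_gt0 y0)); apply: le_trans (spectral_bound _ _).
    by rewrite split_norm mulrBl mul1r lerD2l lerN2 upM.
  rewrite /sin_Theta -[map sin _](map_id) -[id]/(@sc_of_real R OverReal).
  rewrite fro2_rdiag_mul ?minnn ?size_map //.
  rewrite fro2_vec mulr_sumr; apply: ler_sum => c _; rewrite ler_wpM2r ?sqr_ge0 //.
  have cT : (c < \dim T)%N by rewrite -[X in (_ < X)%N]size_sin.
  have /andP[sl0 _] := s01 l; have /andP[sc0 _] := s01 c.
  rewrite sinE // (le_trans _ le_l) // lerD2l lerN2 ler_sqr ?nnegrE //.
  by apply: (svals_mono sM); rewrite -ltnS prednK.
(* For the last index l the defining equations are none: the bound below by the
   smallest cosine holds for every vector. *)
have [C lowM] := courant_fischer_lower l sM.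
rewrite split_norm lerBlDr -lerBlDl.
have lowx : s`_l ^+ 2 * fro2 x <= fro2 (adj Q *m P *m x).
  by apply: lowM; apply/matrixP => -[i ltiC]; exfalso; move: ltiC; rewrite prednK // subnn.
apply: le_trans lowx; rewrite lerBlDl -lerBlDr -[X in X - _]mul1r -mulrBl.
rewrite ler_wpM2r ?fro2_ge0 // -sinE //.
have lS : (l < size (Theta S T))%N by rewrite size_sin.
have := spectral_entry (sin_Theta S T) (Ordinal lS) (Ordinal lS).
rewrite mxE eqxx /= ger0_norm // => le_l.
by apply: lerXn2r => //; rewrite nnegrE ?sin_ge0 //;
   exact: (mxnorm_ge0 Spectral (sin_Theta S T)).
Qed.

End Sines.

(** * Monotone minorants of polynomials *)

Section MonotoneMinorant.
Variable R : realType.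
Local Notation C := (RorC R OverComplex).
Local Notation ofC := (@sc_of_real R OverComplex).

(** One linear factor.  Writing y = y0 - u and gam = 1 / (y0 - rho), the
    normalized factor (y - rho) / (y0 - rho) is 1 - u gam.  Replacing gam by the
    positive part c of its real part can only decrease its modulus for u >= 0,
    and makes the factor real and at least 1 for u <= 0. *)
Lemma linear_factor_minorant (y0 : R) (rho : C) : ofC y0 - rho != 0 ->
  exists2 c : R, 0 <= c & forall y, y <= y0 ->
    `|1 - c * (y0 - y)| * sc_abs (ofC y0 - rho) <= sc_abs (ofC y - rho).
Proof.
case: rho => a d; rewrite -sc_abs_eq0 => N0.
have absE y : sc_abs (ofC y - Complex a d) ^+ 2 = (y - a) ^+ 2 + d ^+ 2.
  by rewrite /= sqr_sqrtr ?addr_ge0 ?sqr_ge0 // sub0r sqrrN.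
set N := sc_abs _ in N0 *; have N_gt0 : 0 < N by rewrite lt_def N0 sc_abs_ge0.
have NE : N ^+ 2 = (y0 - a) ^+ 2 + d ^+ 2 by exact: absE.
have [a_le|a_gt] := lerP (y0 - a) 0.
  exists 0 => // y le_y; rewrite mul0r subr0 normr1 mul1r.
  rewrite -(@ler_pXn2r _ 2) ?nnegrE ?sc_abs_ge0 ?(ltW N_gt0) // NE (absE y).
  nra.
exists ((y0 - a) / N ^+ 2); first by rewrite divr_ge0 ?sqr_ge0 // ltW.
move=> y le_y; rewrite -(@ler_pXn2r _ 2) ?nnegrE ?mulr_ge0 ?sc_abs_ge0 ?(ltW N_gt0) //.
rewrite exprMn real_normK ?num_real // (absE y).
have -> : (1 - (y0 - a) / N ^+ 2 * (y0 - y)) ^+ 2 * N ^+ 2 =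
   N ^+ 2 - 2 * (y0 - a) * (y0 - y) + (y0 - y) ^+ 2 * ((y0 - a) ^+ 2 / N ^+ 2).
  by field.
have le1 : (y0 - a) ^+ 2 / N ^+ 2 <= 1.
  by rewrite ler_pdivrMr ?exprn_gt0 // mul1r NE lerDl sqr_ge0.
apply: (@le_trans _ _ (N ^+ 2 - 2 * (y0 - a) * (y0 - y) + (y0 - y) ^+ 2)).
  by rewrite lerD2l ler_piMr ?sqr_ge0.
by rewrite NE le_eqVlt; apply/orP; left; apply/eqP; ring.
Qed.

Lemma monotone_minorant_prod (y0 : R) (r : seq C) :
  \prod_(z <- r) (ofC y0 - z) != 0 ->
  exists f : {poly R}, [/\ (size f <= (size r).+1)%N, f.[y0] = 1,
    forall y, y0 <= y -> 1 <= f.[y] &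
    forall y, y <= y0 -> `|f.[y]| * sc_abs (\prod_(z <- r) (ofC y0 - z)) <=
                         sc_abs (\prod_(z <- r) (ofC y - z))].
Proof.
elim: r => [|z r IHr].
  exists 1; rewrite size_poly1 hornerC; split => // y _; rewrite hornerC //.
  by rewrite !big_nil normr1 mul1r.
rewrite big_cons mulf_eq0 => /norP[/linear_factor_minorant[c c0 cP] /IHr[f [sf f1 f_ge f_le]]].
pose q : {poly R} := (1 - c * y0)%:P + c *: 'X.
have qE y : q.[y] = 1 - c * (y0 - y) by rewrite !hornerE; ring.
exists (q * f); split.
- have sq : (size q <= 2)%N.
    rewrite (leq_trans (size_polyD _ _)) // geq_max (leq_trans (size_polyC_leq1 _)) //.
    by rewrite (leq_trans (size_scale_leq _ _)) // size_polyX.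
  rewrite (leq_trans (size_polyMleq _ _)) //.
  by move: (size q) (size f) sq sf => a d /= ? ?; lia.
- by rewrite hornerM f1 qE subrr mulr0 subr0 mulr1.
- move=> y le_y; rewrite hornerM qE mulr_ege1 ?f_ge //.
  by rewrite lerDl oppr_ge0 mulr_ge0_le0 // subr_le0.
- move=> y le_y; rewrite hornerM qE normrM !big_cons !sc_absM mulrACA.
  by rewrite ler_pM ?mulr_ge0 ?sc_abs_ge0 ?cP ?f_le.
Qed.

Lemma monotone_minorant_complex (g : {poly C}) (y0 : R) : g.[ofC y0] != 0 ->
  exists f : {poly R}, [/\ (size f <= size g)%N, f.[y0] = 1,
    forall y, y0 <= y -> 1 <= f.[y] &
    forall y, y <= y0 -> `|f.[y]| * sc_abs g.[ofC y0] <= sc_abs g.[ofC y]].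
Proof.
have [r gE] := @closed_field_poly_normal R[i] g.
have hornerg y : g.[ofC y] = (lead_coef g : C) * \prod_(z <- r) (ofC y - z).
  rewrite {1}gE hornerZ horner_prod; congr (_ * _).
  by apply: eq_bigr => z _; rewrite !hornerE.
rewrite hornerg mulf_eq0 => /norP[lg0 /monotone_minorant_prod[f [sf f1 f_ge f_le]]].
exists f; split => //.
  by rewrite gE size_scale // size_prod_XsubC.
move=> y le_y; rewrite !hornerg !sc_absM mulrCA ler_wpM2l ?sc_abs_ge0 //.
exact: f_le.
Qed.

End MonotoneMinorant.

(** The product over the roots of g of the minorants of its linear factors.  A
    real g is factored over the complex numbers; the minorants are real anyway. *)
Lemma monotone_minorant (R : realType) (b : scalar_kind) (g : {poly RorC R b})
    (y0 : R) : g.[sc_of_real b y0] != 0 ->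
  exists f : {poly R}, [/\ (size f <= size g)%N, f.[y0] = 1,
    forall y, y0 <= y -> 1 <= f.[y] &
    forall y, y <= y0 ->
      `|f.[y]| * sc_abs g.[sc_of_real b y0] <= sc_abs g.[sc_of_real b y]].
Proof.
case: b g => g g0; last exact: monotone_minorant_complex.
have mapE y : (map_poly (@sc_of_real R OverComplex) g).[sc_of_real OverComplex y] =
    sc_of_real OverComplex g.[y] by rewrite horner_map.
have [|f [sf f1 f_ge f_le]] :=
    @monotone_minorant_complex R (map_poly (@sc_of_real R OverComplex) g) y0.
  by rewrite mapE sc_of_real_eq0.
exists f; split => //; first by rewrite (leq_trans sf) // size_map_poly.
by move=> y /f_le; rewrite !mapE !sc_abs_of_real.
Qed.

(** * Rank, pseudo-inverse and frames *)

Section Geometry.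
Variables (R : realType) (b : scalar_kind).
Local Notation K := (RorC R b).
Local Notation ofR := (@sc_of_real R b).

Lemma rank_le_kernel m m' n (M : 'M[K]_(m, n)) (N : 'M[K]_(m', n)) :
  (forall x : 'cV_n, M *m x = 0 -> N *m x = 0) -> (\rank N <= \rank M)%N.
Proof.
move=> kerMN; apply: mxrankS; rewrite submxE; apply/eqP/matrixP => i c.
have /matrixP/(_ i 0) : N *m col c (cokermx M) = 0.
  by apply: kerMN; rewrite -col_mul mulmx_coker; apply/matrixP => a d; rewrite !mxE.
by rewrite -col_mul !mxE.
Qed.

(** If the singular value of index i vanishes, the range lies in the span of the
    first i left singular vectors; if not, M is injective on a subspace of dimension i + 1. *)
Lemma rank_gt_svals m n (M : 'M[K]_(m, n)) i : (i < \rank M)%N = (0 < (svals M)`_i).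
Proof.
have sM := svalsP M; have [ss _ _ [U [V [UU VV EM]]]] := sM.
apply/idP/idP => [ltir|s_gt0].
  rewrite lt_def (svals_ge0 _ sM) andbT; apply: contraTneq ltir => si0.
  rewrite -leqNgt; have [im|mi] := leqP i m; last first.
    by apply: leq_trans (ltnW mi); exact: rank_leq_row.
  have -> : M = first_cols i U *m (rdiag i n (map ofR (svals M)) *m adj V).
    rewrite {1}EM mulmxA; congr (_ *m _); apply/matrixP => a c.
    have [ic|ci] := leqP i c.
      rewrite (mul_rdiag0 _ _ _ ic); have [mc|cm] := leqP m c; first exact: mul_rdiag0.
      rewrite (@mul_rdiag _ _ _ _ _ _ _ _ _ (Ordinal cm)) //.
      have -> : (map ofR (svals M))`_c = 0; last by rewrite mulr0.
      have [cs|?] := ltnP c (size (svals M)); last by rewrite nth_default ?size_map.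
      rewrite (nth_map 0) // (_ : _`_c = 0) ?rmorph0 //.
      have := svals_mono sM ic; rewrite si0 => c_le0.
      by apply/le_anti; rewrite c_le0 (svals_ge0 _ sM).
    have cm : (c < m)%N by apply: leq_trans im.
    rewrite (@mul_rdiag _ _ _ _ _ _ _ _ _ (Ordinal cm)) //.
    by rewrite (@mul_rdiag _ _ _ _ _ _ _ _ _ (Ordinal ci)) // (first_colsE _ _ (c' := Ordinal cm)).
  by apply: leq_trans (mxrankM_maxl _ _) _; exact: rank_leq_col.
have ltin : (i < n)%N.
  rewrite ltnNge; apply: contraTN s_gt0 => ni.
  by rewrite nth_default ?ltxx // ss (leq_trans (geq_minr _ _)).
have [C lowM] := courant_fischer_lower i sM.
have : (\rank (1%:M : 'M[K]_n) <= \rank (col_mx C M))%N.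
  apply: rank_le_kernel => x; rewrite mul_col_mx mul1mx => /eqP.
  rewrite col_mx_eq0 => /andP[/eqP Cx /eqP Mx].
  have := lowM _ Cx; rewrite Mx fro2_0 => le0; apply: fro2_eq0; apply/le_anti.
  by rewrite fro2_ge0 andbT -(pmulr_rle0 _ (exprn_gt0 2 s_gt0)).
have [le_add _] := mxrank_adds_leqif C M; rewrite addsmxE in le_add.
rewrite mxrank1 => /leq_trans /(_ le_add).
by have := rank_leq_row C; lia.
Qed.

Lemma adj_invmx n (H : 'M[K]_n) : adj (invmx H) = invmx (adj H).
Proof. by rewrite /adj map_invmx trmx_inv. Qed.

(** With Q an orthonormal basis of the range of Z and C = Q^* Z of full row
    rank, the pseudo-inverse is C^* (C C^* )^-1 Q^*. *)
Lemma penrose_exists m n (Z : 'M[K]_(m, n)) : exists Y, penrose Z Y.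
Proof.
have [] := onb_mxP (colrange Z); set Q := onb_mx _ => QQ RQ.
have QZ : Q *m (adj Q *m Z) = Z by apply: onb_projK (onb_mxP _) (subvv _).
have [C' EQ] : exists C', Q = Z *m C'.
  by apply/colrange_subP; rewrite RQ subvv.
have QQZ : Q *m adj Q *m Z = Z by rewrite -mulmxA QZ.
have [C CE] : exists C, C = adj Q *m Z by exists (adj Q *m Z).
rewrite -CE in QZ.
have CC' : C *m C' = 1%:M by rewrite CE -mulmxA -EQ QQ.
have unitC : C *m adj C \in unitmx.
  rewrite -row_free_unit /row_free eqn_leq rank_leq_row /=.
  have {1}<- := mxrank1 K (\dim (colrange Z)); apply: rank_le_kernel => x CCx; rewrite mul1mx.
  have C0 : adj C *m x = 0.
    apply: fro2_eq0; apply: (@sc_of_real_inj R b).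
    by rewrite fro2E adjM adjK -!mulmxA (mulmxA C) CCx mulmx0 mxtrace0 rmorph0.
  by rewrite -[x]mul1mx -adj1 -CC' adjM -mulmxA C0 mulmx0.
have invH : adj (invmx (C *m adj C)) = invmx (C *m adj C).
  by rewrite adj_invmx adjM adjK.
pose A := adj C *m invmx (C *m adj C).
have CA : C *m A = 1%:M by rewrite mulmxA mulmxV.
have ZY : Z *m (A *m adj Q) = Q *m adj Q by rewrite -{1}QZ -mulmxA (mulmxA C) CA mul1mx.
have YZ : A *m adj Q *m Z = A *m C by rewrite -mulmxA CE.
exists (A *m adj Q); split.
- by rewrite ZY.
- by rewrite YZ -mulmxA (mulmxA C) CA mul1mx.
- by rewrite ZY adjM adjK.
- by rewrite YZ !adjM adjK invH mulmxA.
Qed.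

Lemma mp_inverseK m n (Z : 'M[K]_(m, n)) : Z *m mp_inverse Z *m Z = Z.
Proof.
rewrite /mp_inverse; case: xgetP => [Y -> []//|noY].
by have [Y ZY] := penrose_exists Z; case: (noY Y).
Qed.

Lemma first_cols_mul l m n p (M : 'M[K]_(m, n)) (N : 'M[K]_(n, p)) :
  first_cols l (M *m N) = M *m first_cols l N.
Proof.
apply/matrixP => i c; have [pc|cp] := leqP p c.
  by rewrite !mxE entry_col_out // big1 // => k _; rewrite mxE entry_col_out ?mulr0.
rewrite (first_colsE _ _ (c' := Ordinal cp)) // !mxE; apply: eq_bigr => k _.
by rewrite (first_colsE _ _ (c' := Ordinal cp)).
Qed.

(** Inside the range of Q, of dimension w >= h, there are h - j orthonormal
    vectors orthogonal to the first j coordinate vectors: the trailing right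
    singular vectors of the first j rows of Q are annihilated by these rows. *)
Lemma exists_frame k w j h (Q : 'M[K]_(k, w)) :
  orthonormal_cols Q -> (j <= h)%N -> (h <= w)%N -> (j <= k)%N ->
  exists T : 'M[K]_(k, h),
    [/\ orthonormal_cols T,
        forall (a : 'I_k) (c : 'I_h), (c < j)%N -> T a c = (a == c :> nat)%:R,
        forall (a : 'I_k) (c : 'I_h), (a < j)%N -> (j <= c)%N -> T a c = 0 &
        forall c : 'I_h, (j <= c)%N -> exists y, col c T = Q *m y].
Proof.
move=> QQ jh hw jk; pose E := first_cols j (1%:M : 'M[K]_k).
have [_ _ _ [U [V [UU VV EM]]]] := svalsP (adj E *m Q).
pose Y := Q *m V; have YY : orthonormal_cols Y by apply: orthonormal_mul.
have Y0 (a : 'I_k) (c : 'I_w) : (a < j)%N -> (j <= c)%N -> Y a c = 0.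
  move=> aj jc; have : (adj E *m Y) (Ordinal aj) c = 0.
    by rewrite mulmxA EM -mulmxA VV mulmx1 mul_rdiag0.
  rewrite mxE (bigD1 a) //= big1 => [|d da].
    by rewrite adjE (first_colsE _ _ (c' := a)) // mxE eqxx rmorph1 mul1r addr0.
  by rewrite adjE (first_colsE _ _ (c' := a)) // mxE (negPf da) rmorph0 mul0r.
pose T : 'M[K]_(k, h) :=
  \matrix_(a, c) if (c < j)%N then (a == c :> nat)%:R else Y a (widen_ord hw c).
have Tl (a : 'I_k) (c : 'I_h) : (c < j)%N -> T a c = (a == c :> nat)%:R by move=> cj; rewrite mxE cj.
have Tr (a : 'I_k) (c : 'I_h) : (j <= c)%N -> T a c = Y a (widen_ord hw c).
  by move=> jc; rewrite mxE ltnNge jc.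
have T0 (a : 'I_k) (c : 'I_h) : (a < j)%N -> (j <= c)%N -> T a c = 0.
  by move=> aj jc; rewrite Tr // Y0.
exists T; split => //; last first.
  move=> c jc; exists (col (widen_ord hw c) V); rewrite -col_mul.
  by apply/matrixP => a d; rewrite mxE Tr // !mxE.
have TT_l (c d : 'I_h) : (c < j)%N -> (adj T *m T) c d = (c == d)%:R.
  move=> cj; have ck : (c < k)%N by apply: leq_trans jk.
  rewrite mxE (bigD1 (Ordinal ck)) //= big1 => [|a ac].
    rewrite adjE Tl //= eqxx rmorph1 mul1r addr0.
    have [dj|jd] := ltnP d j; first by rewrite Tl.
    rewrite T0 //; case: eqP => // cd; by move: cj; rewrite cd ltnNge jd.
  rewrite adjE Tl // (_ : (a == c :> nat) = false) ?rmorph0 ?mul0r //.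
  by apply: contraNF ac => /eqP ac; apply/eqP/val_inj.
apply/matrixP => c d; rewrite [RHS]mxE.
have [cj|jc] := ltnP c j; first exact: TT_l.
have [dj|jd] := ltnP d j.
  have TTh : adj (adj T *m T) = adj T *m T by rewrite adjM adjK.
  by rewrite -TTh adjE TT_l // rmorph_nat eq_sym.
have /matrixP/(_ (widen_ord hw c) (widen_ord hw d)) := YY; rewrite [RHS]mxE.
rewrite -(inj_eq val_inj) /= (inj_eq val_inj) => <-; rewrite !mxE.
by apply: eq_bigr => a _; rewrite !adjE !Tr.
Qed.

End Geometry.

(** * Stretching a subspace *)

Section StretchedFrame.
Variables (R : realType) (b : scalar_kind).
Local Notation K := (RorC R b).
Local Notation ofR := (@sc_of_real R b).

Definition real_diag k (d : 'I_k -> R) : 'M[K]_k := diag_mx (\row_i ofR (d i)).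

Lemma mul_real_diag k n (d : 'I_k -> R) (M : 'M[K]_(k, n)) i c :
  (real_diag d *m M) i c = ofR (d i) * M i c.
Proof. by rewrite /real_diag mul_diag_mx !mxE. Qed.

Lemma adj_real_diag k (d : 'I_k -> R) : adj (real_diag d) = real_diag d.
Proof.
apply/matrixP => i c; rewrite adjE !mxE eq_sym.
by case: eqP => [->|_]; rewrite ?mulr1n ?mulr0n ?rmorph0 ?sc_conj_of_real.
Qed.

Lemma fro2_real_diag k n (d : 'I_k -> R) (M : 'M[K]_(k, n)) :
  (forall i, 1 <= d i) -> fro2 M <= fro2 (real_diag d *m M).
Proof.
move=> d1; apply: ler_sum => i _; apply: ler_sum => c _.
rewrite mul_real_diag sc_absM sc_abs_of_real exprMn ler_peMl ?sqr_ge0 //.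
by rewrite expr_ge1 // (le_trans (d1 i)) ?ler_norm.
Qed.

Lemma fro2_first_coords k j (jk : (j <= k)%N) (z : 'cV[K]_k) :
  fro2 (adj (first_cols j (1%:M : 'M[K]_k)) *m z) =
  \sum_(i < k | (i < j)%N) sc_abs (z i 0) ^+ 2.
Proof.
rewrite (big_ord_narrow jk) fro2_vec; apply: eq_bigr => c _.
congr (sc_abs _ ^+ 2); rewrite mxE (bigD1 (widen_ord jk c)) //= big1 => [|i ic].
  by rewrite adjE (first_cols_widen jk) mxE eqxx rmorph1 mul1r addr0.
by rewrite adjE (first_cols_widen jk) mxE (negPf ic) rmorph0 mul0r.
Qed.

(** Stretching the first j coordinates moves a subspace towards them.
    The orthogonal complement of the stretched subspace D W is D^-1 W^perp: a
    vector z orthogonal to D W gives D z orthogonal to W, whose first j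
    coordinates carry at least the same share of the norm as those of z.  This is the
    hypothesis of the comparison of singular values, for the adjoints. *)
Lemma stretched_frame_gap nu k j h r w w' (jk : (j <= k)%N) (d : 'I_k -> R)
    (Z : 'M[K]_(k, r)) (Q : 'M[K]_(k, w)) (Q' : 'M[K]_(k, w')) (T : 'M[K]_(k, h)) :
  (forall i, 1 <= d i) -> (forall i : 'I_k, (j <= i)%N -> d i = 1) ->
  is_onb (colrange Z) Q -> is_onb (colrange (real_diag d *m Z)) Q' ->
  (forall (a : 'I_k) (c : 'I_h), (c < j)%N -> T a c = (a == c :> nat)%:R) ->
  (forall (a : 'I_k) (c : 'I_h), (a < j)%N -> (j <= c)%N -> T a c = 0) ->
  (forall c : 'I_h, (j <= c)%N -> exists y, col c T = Z *m y) ->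
  mxnorm nu (T - Q' *m (adj Q' *m T)) <=
  mxnorm nu (first_cols j 1%:M - Q *m (adj Q *m first_cols j 1%:M)).
Proof.
move=> d1 dj1 WQ WQ' Tl T0 TZ; set E := first_cols j _.
rewrite -mxnorm_adj -[leRHS]mxnorm_adj -[leRHS]mul1r !adjB !adjM !adjK.
set D := real_diag d in WQ' *.
(* D fixes the trailing columns of T, so they lie in D W as well as in W. *)
have D_T (c : 'I_h) : (j <= c)%N -> D *m col c T = col c T.
  move=> jc; apply/matrixP => a e; rewrite mul_real_diag.
  have [aj|ja] := ltnP a j; first by rewrite mxE T0 // mulr0.
  by rewrite dj1 // rmorph1 mul1r.
have [Q'Q' RQ'] := WQ'; have [QQ RQ] := WQ.
have QDZ : Q' *m (adj Q' *m (D *m Z)) = D *m Z by apply: onb_projK WQ' (subvv _).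
have [C QE] : exists C, Q = Z *m C by apply/colrange_subP; rewrite RQ subvv.
apply: (@mxnorm_comparison _ _ _ _ _ _ _ _ _ (D *m (1%:M - Q' *m adj Q'))) => // x.
  rewrite expr1n mul1r -(mulmxA D); set z := (1%:M - Q' *m adj Q') *m x.
  have zE : z = x - Q' *m (adj Q' *m x) by rewrite /z mulmxBl mul1mx mulmxA.
  have DZz : adj (D *m Z) *m z = 0.
    rewrite -[X in adj X]QDZ !adjM adjK -[_ *m adj Q' *m z]mulmxA.
    by rewrite zE mulmxBr (mulmxA (adj Q')) Q'Q' mul1mx subrr mulmx0.
  have QDz : adj Q *m (D *m z) = 0.
    by rewrite QE adjM -mulmxA (mulmxA (adj Z)) -[D in adj Z *m D](adj_real_diag d) -adjM DZz mulmx0.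
  have -> : (adj T - adj T *m Q' *m adj Q') *m x = adj T *m z.
    by rewrite zE mulmxBl mulmxBr -!mulmxA.
  have -> : (adj E - adj E *m Q *m adj Q) *m (D *m z) = adj E *m (D *m z).
    by rewrite mulmxBl -[_ *m adj Q *m _]mulmxA QDz mulmx0 subr0.
  (* The rows of T^* from the index j on vanish on z, so E may replace T. *)
  have TzE : fro2 (adj T *m z) <= fro2 (adj E *m z).
    rewrite (fro2_first_coords jk) fro2_vec.
    pose g i := if (i < j)%N then sc_abs (entry z i 0) ^+ 2 else 0.
    have gl (c : 'I_h) : sc_abs ((adj T *m z) c 0) ^+ 2 <= g c.
      rewrite /g; case: ltnP => [cj|jc].
        have ck : (c < k)%N by apply: leq_trans jk.
        rewrite mxE (bigD1 (Ordinal ck)) //= big1 => [|a ac].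
          rewrite adjE Tl //= eqxx rmorph1 mul1r addr0.
          by rewrite -(entry_vec z (Ordinal ck)).
        rewrite adjE Tl // (_ : (a == c :> nat) = false) ?rmorph0 ?mul0r //.
        by apply: contraNF ac => /eqP ac; apply/eqP/val_inj.
      have -> : (adj T *m z) c 0 = (adj (col c T) *m z) 0 0.
        by rewrite !mxE; apply: eq_bigr => a _; rewrite !adjE; congr (sc_conj _ * _); rewrite mxE.
      have [y yE] := TZ c jc.
      have -> : adj (col c T) *m z = 0.
        by rewrite -(D_T c jc) yE (mulmxA D) adjM -mulmxA DZz mulmx0.
      by rewrite mxE sc_abs0 expr0n.
    have g_ge0 i : 0 <= g i by rewrite /g; case: ifP; rewrite ?sqr_ge0.
    have gE : \sum_(i < k | (i < j)%N) sc_abs (z i 0) ^+ 2 = \sum_(i < k) g i.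
      rewrite [RHS](bigID (fun i : 'I_k => i < j)%N) /= [X in _ = _ + X]big1.
        by rewrite addr0; apply: eq_bigr => i ij; rewrite /g ij entry_vec.
      by move=> i; rewrite /g => /negPf ->.
    rewrite gE; apply: le_trans (ler_sum _ (fun c _ => gl c)) _.
    have g0 i : (j <= i)%N -> g i = 0 by move=> ji; rewrite /g ltnNge ji.
    rewrite (sum_ord_support jk g0); have [hj|jh] := leqP h j.
      by rewrite (big_ord_widen j g hj) big_mkcond /=; apply: ler_sum => i _; case: ifP.
    by rewrite (sum_ord_support (ltnW jh) g0).
  have Ez_le : fro2 (adj E *m z) <= fro2 (adj E *m (D *m z)).
    rewrite !(fro2_first_coords jk); apply: ler_sum => i _.
    rewrite mul_real_diag sc_absM sc_abs_of_real exprMn ler_peMl ?sqr_ge0 //.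
    by rewrite expr_ge1 // (le_trans (d1 i)) ?ler_norm.
  have z_le : fro2 z <= fro2 x.
    by rewrite [leRHS](fro2_proj x Q'Q') -zE lerDr fro2_ge0.
  have splitz : exists e, [/\ 0 <= e, fro2 z = fro2 (adj E *m z) + e &
                            fro2 (D *m z) = fro2 (adj E *m (D *m z)) + e].
    exists (\sum_(i < k | ~~ (i < j)%N) sc_abs (z i 0) ^+ 2); split.
    - by rewrite sumr_ge0 // => i _; rewrite sqr_ge0.
    - by rewrite fro2_vec (bigID (fun i : 'I_k => i < j)%N) /= (fro2_first_coords jk).
    - rewrite fro2_vec (bigID (fun i : 'I_k => i < j)%N) /= (fro2_first_coords jk).
      congr (_ + _); apply: eq_bigr => i; rewrite -leqNgt => ji.
      by rewrite mul_real_diag dj1 // rmorph1 mul1r.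
  case: splitz => e [e0 zS DzS].
  have a0 := fro2_ge0 (adj E *m z); have t0 := fro2_ge0 (adj T *m z).
  apply: (@le_trans _ _ (fro2 (adj E *m z) * fro2 (D *m z))).
    by rewrite ler_wpM2r ?fro2_ge0.
  apply: (@le_trans _ _ (fro2 (adj E *m (D *m z)) * fro2 z)); last first.
    by rewrite ler_wpM2l ?fro2_ge0.
  by rewrite zS DzS !mulrDr mulrC lerD2l ler_wpM2r.
rewrite -mulmxA => Dz0.
have /fro2_eq0 z0 : fro2 ((1%:M - Q' *m adj Q') *m x) = 0.
  apply/le_anti; rewrite fro2_ge0 andbT -(fro2_0 R b k 1) -Dz0.
  exact: fro2_real_diag.
have zE : x - Q' *m (adj Q' *m x) = 0 by rewrite -z0 mulmxBl mul1mx mulmxA.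
by rewrite mulmxBl -!mulmxA -mulmxBr zE mulmx0.
Qed.

End StretchedFrame.

(** * Functional calculus on the singular values *)

Section SVDCalculus.
Variables (R : realType) (b : scalar_kind).
Local Notation K := (RorC R b).
Local Notation ofR := (@sc_of_real R b).

Lemma nth_map_zero (S T : nmodType) (f : S -> T) (s : seq S) i :
  f 0 = 0 -> (map f s)`_i = f s`_i.
Proof.
move=> f0; have [?|?] := ltnP i (size s); first exact: nth_map.
by rewrite !nth_default ?size_map.
Qed.

Lemma nth_map_ofR (s : seq R) i : (map ofR s)`_i = ofR s`_i.
Proof. by rewrite nth_map_zero // rmorph0. Qed.

Lemma mul_real_diag_rdiag m n (d : nat -> R) (s : seq R) :
  real_diag b (fun a : 'I_m => d a) *m rdiag m n (map ofR s) =
  rdiag m n (map ofR (mkseq (fun i => d i * s`_i) (size s))).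
Proof.
apply/matrixP => a c; rewrite mul_real_diag !mxE; case: eqP => _; last by rewrite mulr0.
rewrite !nth_map_ofR -rmorphM /=; have [as_|sa] := ltnP a (size s).
  by rewrite nth_mkseq.
by rewrite !nth_default ?size_mkseq // mulr0.
Qed.

Lemma svd_left_eigen m n (A : 'M[K]_(m, n)) U V : full_svd A U V ->
  A *m adj A *m U = U *m real_diag b (fun a : 'I_m => (svals A)`_a ^+ 2).
Proof.
case=> UU VV EA; have ss := size_svals A; set s := svals A in EA ss *.
have -> : A *m adj A *m U = U *m (Sigma A *m rdiag n m (map ofR s)).
  by rewrite {1 2}EA !adjM adjK adj_rdiag -!mulmxA UU mulmx1 (mulmxA (adj V)) VV mul1mx.
congr (_ *m _); apply/matrixP => a c; rewrite [RHS]mxE [(\row__ _) 0 _]mxE.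
have [nc|cn] := leqP n c.
  rewrite mul_rdiag0 //; case: eqP => // ->.
  by rewrite nth_default ?expr0n ?rmorph0 // ss (leq_trans (geq_minr _ _)).
rewrite (@mul_rdiag _ _ _ _ _ _ _ _ _ (Ordinal cn)) // mxE /= -val_eqE /=.
by rewrite !nth_map_ofR; case: eqP => [->|_]; rewrite ?mul0r // -rmorphM.
Qed.

Lemma svd_adj m n (A : 'M[K]_(m, n)) U V : full_svd A U V ->
  svals (adj A) = svals A /\ full_svd (adj A) V U.
Proof.
move=> [UU VV EA]; have EsA : svals (adj A) = svals A.
  apply: svalsE; have [ss srt s0 _] := svalsP A; split => //; first by rewrite minnC.
  by exists V, U; split => //; rewrite {1}EA !adjM adjK adj_rdiag mulmxA.
split=> //; split => //.
by rewrite /Sigma EsA {1}EA !adjM adjK adj_rdiag mulmxA.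
Qed.

Lemma svd_odd_power m n (A : 'M[K]_(m, n)) U V i : full_svd A U V ->
  (A *m adj A) ^+ i *m A =
  U *m rdiag m n (map ofR (map (fun x => x ^+ (2 * i).+1) (svals A))) *m adj V.
Proof.
move=> svdA; have [UU VV EA] := svdA; elim: i => [|i IHi].
  rewrite expr0 -[X in X *m _ = _]/(1%:M) mul1mx {1}EA /Sigma.
  by rewrite -[in LHS](map_id (svals A)).
rewrite exprS -mulmxE -mulmxA IHi !mulmxA (svd_left_eigen svdA) -(mulmxA U).
congr (_ *m _ *m _).
rewrite (@mul_real_diag_rdiag m n (fun a => (svals A)`_a ^+ 2)); congr rdiag.
congr (map ofR _).
apply: (@eq_from_nth _ 0); rewrite size_mkseq !size_map // => k lk.
rewrite nth_mkseq // !(nth_map 0) //.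
by rewrite -exprD; congr (_ ^+ _); lia.
Qed.

(** (A A^* )^i A acts on the singular values as x^(2i+1), so x f(x^2) acts as the
    combination of the first t + 1 blocks with the coefficients of f. *)
Lemma svd_poly_krylov m n r t (A : 'M[K]_(m, n)) U V (f : {poly R}) (X : 'M[K]_(n, r)) :
  full_svd A U V -> (size f <= t.+1)%N ->
  (colrange (U *m rdiag m n (map ofR (map (fun x => x * f.[x ^+ 2]) (svals A))) *m
             adj V *m X) <= krylov t A X)%VS.
Proof.
move=> svdA sf; apply/colrange_subP.
exists (\mxcol_(i < t.+1) (ofR f`_i)%:M); rewrite mul_mxrow_mxcol.
have -> : U *m rdiag m n (map ofR (map (fun x => x * f.[x ^+ 2]) (svals A))) *m adj V =
          \sum_(i < t.+1) ofR f`_i *: ((A *m adj A) ^+ i *m A).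
  have -> : rdiag m n (map ofR (map (fun x => x * f.[x ^+ 2]) (svals A))) =
      \sum_(i < t.+1) ofR f`_i *:
         rdiag m n (map ofR (map (fun x => x ^+ (2 * i).+1) (svals A))).
    apply/matrixP => a c; rewrite summxE mxE.
    under eq_bigr => i _ do rewrite !mxE.
    case: eqP => _; last by rewrite big1 // => i _; rewrite mulr0.
    rewrite nth_map_ofR nth_map_zero ?mul0r //.
    under eq_bigr => i _ do
      rewrite nth_map_ofR nth_map_zero ?expr0n // -(rmorphM ofR).
    rewrite -(rmorph_sum ofR) (horner_coef_wide _ sf) mulr_sumr; congr ofR.
    by apply: eq_bigr => i _; rewrite (exprS _ (2 * i)) (exprM _ 2 i); ring.
  rewrite mulmx_sumr mulmx_suml; apply: eq_bigr => i _.
  by rewrite -scalemxAr -scalemxAl (svd_odd_power _ svdA).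
rewrite mulmx_suml; apply: eq_bigr => i _.
by rewrite mul_mx_scalar -scalemxAl.
Qed.

Lemma first_last_cols_split k n (V : 'M[K]_n) : (k <= n)%N -> unitary V ->
  first_cols k V *m adj (first_cols k V) + last_cols k V *m adj (last_cols k V) = 1%:M.
Proof.
move=> kn /unitary_mul_adj <-; apply/matrixP => a c; rewrite !mxE.
pose g i := entry V a i * sc_conj (entry V c i).
transitivity (\sum_(i < n) g i); last by apply: eq_bigr => i _; rewrite adjE /g !entryE.
rewrite -(big_mkord xpredT g) (big_cat_nat (n := k)) //= big_mkord.
have -> : \sum_(k <= i < n) g i = \sum_(i < n - k) g (k + i)%N.
  by rewrite -{1}[k]add0n big_addn big_mkord; apply: eq_bigr => i _; rewrite addnC.
by congr (_ + _); apply: eq_bigr => i _; rewrite adjE !mxE.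
Qed.

Lemma svd_first_cols k m n (A : 'M[K]_(m, n)) (U : 'M[K]_m) (V : 'M[K]_n) (w : seq R)
    (km : (k <= m)%N) (kn : (k <= n)%N) : unitary V ->
  U *m rdiag m n (map ofR w) *m adj V *m first_cols k V =
  first_cols k U *m real_diag b (fun c : 'I_k => w`_c).
Proof.
move=> VV; rewrite -first_cols_mul -mulmxA VV mulmx1; apply/matrixP => i c.
rewrite (first_cols_widen kn) (@mul_rdiag _ _ _ _ _ _ _ _ _ (widen_ord km c)) //.
rewrite mul_mx_diag !mxE nth_map_ofR; congr (_ * _).
by rewrite -(first_cols_widen km) mxE.
Qed.

Lemma last_colsE l m n (M : 'M[K]_(m, n)) i (c : 'I_(n - l)) (c' : 'I_n) :
  (l + c)%N = c' :> nat -> last_cols l M i c = M i c'.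
Proof. by move=> Ec; rewrite mxE Ec entryE. Qed.

Lemma last_cols_index l n (c : 'I_(n - l)) : (l + c < n)%N.
Proof. by have := ltn_ord c; lia. Qed.

Lemma orthonormal_last_cols l m n (Q : 'M[K]_(m, n)) :
  orthonormal_cols Q -> orthonormal_cols (last_cols l Q).
Proof.
move=> /matrixP QQ; apply/matrixP => i c.
have := QQ (Ordinal (last_cols_index i)) (Ordinal (last_cols_index c)).
rewrite !mxE -(inj_eq val_inj) /= eqn_add2l => <-; apply: eq_bigr => a _.
by rewrite !adjE (last_colsE _ _ (c' := Ordinal (last_cols_index i))) //
  (last_colsE _ _ (c' := Ordinal (last_cols_index c))).
Qed.

Lemma orthogonal_last_cols l m n (Q : 'M[K]_(m, n)) (i : 'I_n) (c : 'I_(n - l)) :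
  orthonormal_cols Q -> (i < l)%N -> (adj Q *m last_cols l Q) i c = 0.
Proof.
move=> /matrixP/(_ i (Ordinal (last_cols_index c))) QQ il.
have -> : (adj Q *m last_cols l Q) i c = (adj Q *m Q) i (Ordinal (last_cols_index c)).
  rewrite !mxE; apply: eq_bigr => a _; congr (_ * _).
  exact: last_colsE.
by rewrite QQ mxE -val_eqE /= ltn_eqF // (leq_trans il) // leq_addr.
Qed.

(** V_(k,perp) y has no coordinate along the first k right singular vectors, so
    only the values of w from the index k on act on it. *)
Lemma svd_last_cols_bound k m n (U : 'M[K]_m) (V : 'M[K]_n) (w : seq R) (alpha : R)
    (y : 'cV[K]_(n - k)) :
  unitary U -> unitary V -> size w = minn m n -> 0 <= alpha ->
  (forall i, (k <= i)%N -> `|w`_i| <= alpha) ->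
  fro2 (U *m rdiag m n (map ofR w) *m adj V *m last_cols k V *m y) <= alpha ^+ 2 * fro2 y.
Proof.
move=> UU VV sw alpha0 le_w; rewrite -!mulmxA fro2_isom // fro2_rdiag_mul //.
rewrite -(fro2_isom y (orthonormal_last_cols k VV)).
rewrite -(fro2_isom (last_cols k V *m y) (unitary_adj VV)) fro2_vec mulr_sumr.
apply: ler_sum => c _; have [kc|ck] := leqP k c.
  rewrite ler_wpM2r ?sqr_ge0 // -[w`_c ^+ 2](real_normK (num_real _)).
  by rewrite ler_sqr ?nnegrE ?normr_ge0 // le_w.
suff -> : (adj V *m (last_cols k V *m y)) c 0 = 0 by rewrite sc_abs0 expr0n !mulr0.
by rewrite mulmxA mxE big1 // => i _; rewrite orthogonal_last_cols // mul0r.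
Qed.

End SVDCalculus.

Section Indices.
Variables (R : realType) (b : scalar_kind) (m n : nat) (A : 'M[RorC R b]_(m, n)).
Variables (h : nat) (h_ge1 : (1 <= h)%N) (h_le : (h <= \rank A)%N).
Local Notation s := (svals A).

Lemma sigma_pos l : (0 < l)%N -> sigma A l = (s`_l.-1)%:E.
Proof. by case: l. Qed.

Lemma j_index_lt : (j_index A h < h)%N.
Proof.
rewrite /j_index big_seq_cond; elim/big_ind: _ => //.
  by move=> x y xh yh; rewrite gtn_max xh.
by move=> i; rewrite mem_index_iota => /andP[/andP[_]].
Qed.

(** Past j no singular value before sigma_h exceeds sigma_h, by maximality of j,
    and none is smaller, since they decrease. *)
Lemma j_index_tie i : (j_index A h <= i)%N -> (i < h)%N -> s`_i = s`_h.-1.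
Proof.
move=> ji ih; have sA := svalsP A; apply/le_anti/andP; split; last first.
  by apply: (svals_mono sA); rewrite -ltnS prednK.
have [<-//|ih'] := eqVneq i.+1 h.
have lt_ih : (i.+1 < h)%N by rewrite ltn_neqAle ih'.
rewrite leNgt; apply/negP => lt_s; move: ji; rewrite leqNgt => /negP; apply.
rewrite /j_index (big_rem i.+1) /=; last by rewrite mem_index_iota.
by rewrite !sigma_pos // lte_fin lt_s leq_max leqnn.
Qed.

Lemma k_index_ge : (h <= k_index A h)%N.
Proof.
rewrite /k_index (big_rem h) /=; last by rewrite mem_index_iota h_ge1 ltnS.
by rewrite eqxx leq_maxl.
Qed.

Lemma k_index_spec : (k_index A h <= \rank A)%N /\ s`_(k_index A h).-1 = s`_h.-1.
Proof.
have : k_index A h = 0%N \/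
    [/\ 0 < k_index A h, k_index A h <= \rank A & sigma A (k_index A h) = sigma A h]%N.
  rewrite /k_index big_seq_cond; elim/big_ind: _ => [|x y|i]; first by left.
    by rewrite /maxn; case: ifP.
  rewrite mem_index_iota ltnS => /andP[/andP[i0 ir] /eqP Ei]; right; split => //.
case=> [k0|[k0 kr]]; first by have := k_index_ge; rewrite k0 leqNgt h_ge1.
by rewrite !sigma_pos // => -[].
Qed.

(** A tie past k would have a positive value, hence an index within the rank,
    against the maximality of k. *)
Lemma k_index_gap i : (k_index A h <= i)%N -> s`_i < s`_h.-1.
Proof.
move=> ki; have sA := svalsP A; have h_gt0 : 0 < s`_h.-1.
  by rewrite -rank_gt_svals prednK.
rewrite lt_neqAle (svals_mono sA) ?andbT; last first.
  by rewrite (leq_trans _ ki) // (leq_trans (leq_pred _)) // k_index_ge.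
apply/eqP => Ei; have ir : (i < \rank A)%N by rewrite rank_gt_svals Ei.
move: ki; rewrite leqNgt => /negP; apply.
rewrite /k_index (big_rem i.+1) /=; last by rewrite mem_index_iota.
by rewrite !sigma_pos //= Ei eqxx leq_max leqnn.
Qed.

Lemma index_tie i : (j_index A h <= i)%N -> (i < k_index A h)%N -> s`_i = s`_h.-1.
Proof.
move=> ji ik; have sA := svalsP A.
have [ih|hi] := ltnP i h; first exact: j_index_tie.
apply/le_anti/andP; split.
  by apply: (svals_mono sA); rewrite (leq_trans (leq_pred _)).
have [_ <-] := k_index_spec; apply: (svals_mono sA).
by rewrite -ltnS prednK // (leq_ltn_trans _ ik).
Qed.

End Indices.

(** The polynomial phi may take small values at sigma_1, .., sigma_j.  It is
    traded for a real odd polynomial x f(x^2), within the same degree bound, that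
    equals 1 at sigma_h, is at least 1 beyond, and is dominated by
    phi / phi(sigma_h) between 0 and sigma_h.  With phi(x) = x g(x^2), f is the
    minorant of g at sigma_h^2 divided by sigma_h. *)
Lemma monotone_filter (R : realType) (b : scalar_kind) (t : nat)
    (phi : {poly RorC R b}) (sig : R) :
  (size phi <= (2 * t + 1).+1)%N -> (forall i, ~~ odd i -> phi`_i = 0) ->
  0 < sig -> phi.[sc_of_real b sig] != 0 ->
  exists f : {poly R}, [/\ (size f <= t.+1)%N, sig * f.[sig ^+ 2] = 1,
    forall x, sig <= x -> 1 <= x * f.[x ^+ 2] &
    forall x, 0 <= x -> x <= sig ->
      `|x * f.[x ^+ 2]| * sc_abs phi.[sc_of_real b sig] <= sc_abs phi.[sc_of_real b x]].
Proof.
move=> phi_size phi_odd sig0 phi0; pose g := odd_poly phi.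
have phiE x : phi.[sc_of_real b x] = g.[sc_of_real b (x ^+ 2)] * sc_of_real b x.
  have -> : phi = (g \Po 'X^2) * 'X.
    rewrite -[LHS]poly_even_odd (_ : even_poly phi = 0) ?comp_poly0 ?add0r //.
    by apply/polyP => i; rewrite coef_even_poly coef0 phi_odd // odd_double.
  by rewrite hornerM horner_comp hornerXn hornerX rmorphXn.
have sg : (size g <= t.+1)%N.
  by rewrite (leq_trans (size_odd_poly _)) // (leq_trans (half_leq phi_size)) //; lia.
have g0 : g.[sc_of_real b (sig ^+ 2)] != 0.
  by move: phi0; rewrite phiE mulf_eq0 => /norP[].
have [f [sf f1 f_ge f_le]] := monotone_minorant g0.
have hornerf x : x * (sig^-1 *: f).[x ^+ 2] = x / sig * f.[x ^+ 2].
  by rewrite hornerZ mulrA.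
exists (sig^-1 *: f); split.
- by rewrite (leq_trans (size_scale_leq _ _)) // (leq_trans sf).
- by rewrite hornerf f1 mulr1 divff // gt_eqF.
- move=> x le_x; rewrite hornerf mulr_ege1 //; first by rewrite ler_pdivlMr // mul1r.
  by apply: f_ge; rewrite ler_sqr ?nnegrE ?(ltW sig0) ?(le_trans (ltW sig0)).
- move=> x x0 le_x; rewrite hornerf normrM !phiE !sc_absM !sc_abs_of_real.
  rewrite (ger0_norm (divr_ge0 x0 (ltW sig0))) (ger0_norm x0) (gtr0_norm sig0).
  have -> : x / sig * `|f.[x ^+ 2]| * (sc_abs g.[sc_of_real b (sig ^+ 2)] * sig) =
            `|f.[x ^+ 2]| * sc_abs g.[sc_of_real b (sig ^+ 2)] * x.
    by field; rewrite gt_eqF.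
  by rewrite ler_wpM2r // f_le // ler_sqr ?nnegrE // (ltW sig0).
Qed.

(** * Compatibility and compression of angles *)

Section Compatibility.
Variables (R : realType) (b : scalar_kind).
Local Notation K := (RorC R b).
Local Notation ofR := (@sc_of_real R b).

(** Eigenvectors of A^* A for eigenvalues that are at least sigma_h^2 are
    orthogonal to the columns of V from the index k on, whose eigenvalues are
    smaller than sigma_h^2. *)
Lemma right_dominant_sub m n h k p (A : 'M[K]_(m, n)) U V
    (S : {vspace 'cV[K]_n}) (B : 'M[K]_(n, p)) :
  full_svd A U V -> (k <= n)%N -> right_dominant A h S ->
  (forall i, (k <= i)%N -> (svals A)`_i < (svals A)`_h.-1) ->
  (colrange B <= S)%VS ->
  first_cols k V *m (adj (first_cols k V) *m B) = B.
Proof.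
move=> svdA kn [_ [Z [[_ RZ] eigZ]]] gap; rewrite -RZ => /colrange_subP[C ->].
have [EsA svdA'] := svd_adj svdA; have [UU VV EA] := svdA; have sA := svalsP A.
have := svd_left_eigen svdA'; rewrite adjK EsA => /(congr1 (@adj _ _ _ _)).
rewrite !adjM adjK adj_real_diag => eigV.
suff VZ : adj (last_cols k V) *m Z = 0.
  rewrite !(mulmxA _ _ C) mulmxA -[RHS]mul1mx -(first_last_cols_split kn VV) mulmxDl.
  by rewrite -[X in _ + X]mulmxA (mulmxA (adj (last_cols k V))) VZ mul0mx mulmx0 addr0 !mulmxA.
apply/matrixP => c i; rewrite [RHS]mxE.
pose c' := Ordinal (last_cols_index c).
have -> : (adj (last_cols k V) *m Z) c i = (adj V *m Z) c' i.
  rewrite !mxE; apply: eq_bigr => a _; rewrite !adjE.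
  by rewrite (last_colsE _ _ (c' := c')).
have : (adj V *m (adj A *m A) *m Z) c' i = (adj V *m (adj A *m A) *m Z) c' i by [].
rewrite {1}eigV -mulmxA mul_real_diag -mulmxA.
have -> : (adj V *m (adj A *m A *m Z)) c' i = (adj V *m (adj A *m A *m col i Z)) c' 0.
  by rewrite -col_mul -col_mul [RHS]mxE.
rewrite eigZ -scalemxAr; set x := (adj V *m Z) c' i.
have -> : (sigmaK A i.+1 ^+ 2 *: (adj V *m col i Z)) c' 0 = sigmaK A i.+1 ^+ 2 * x.
  by rewrite mxE -col_mul; congr (_ * _); rewrite mxE.
move/eqP.
rewrite -subr_eq0 -mulrBl mulf_eq0 => /orP[|/eqP //].
rewrite /sigmaK /= -rmorphXn -rmorphB /= sc_of_real_eq0 subr_eq0.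
rewrite eqrXn2 ?(svals_ge0 _ sA) // => /eqP Ei; exfalso.
have := gap c' (leq_addr _ _); rewrite Ei ltNge (svals_mono sA) // -ltnS prednK //.
by apply: leq_ltn_trans (ltn_ord i).
Qed.

(** A dominant subspace lies in the span of V_k, so that the angles between it
    and R(X), being less than pi/2, are seen through V_k^* X. *)
Lemma compatible_rank m n r h k (A : 'M[K]_(m, n)) U V (X : 'M[K]_(n, r)) :
  full_svd A U V -> (k <= n)%N -> (0 < h)%N -> h_compatible A X h ->
  (forall i, (k <= i)%N -> (svals A)`_i < (svals A)`_h.-1) ->
  (h <= \rank (adj (first_cols k V) *m X))%N.
Proof.
move=> svdA kn h0 [S [domS hX angles]] gap; have [dimS _] := domS.
have [PP RP] := onb_mxP S; have [QQ RQ] := onb_mxP (colrange X).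
set P := onb_mx S in PP RP; set Q := onb_mx (colrange X) in QQ RQ.
have VP : first_cols k V *m (adj (first_cols k V) *m P) = P.
  by apply: right_dominant_sub gap _ => //; first exact: svdA; rewrite ?RP ?subvv.
have [C QE] : exists C, Q = X *m C by apply/colrange_subP; rewrite RQ subvv.
have size_s : size (svals (adj P *m Q)) = h.
  by rewrite size_svals dimS dim_colrange; apply/minn_idPl.
have ltS : (h.-1 < h)%N by rewrite prednK.
have s_gt0 : 0 < (svals (adj P *m Q))`_h.-1.
  have /andP[s0 s1] := @svals_cross_le1 _ _ _ _ _ P Q h.-1 PP QQ.
  rewrite lt_def s0 andbT; apply/eqP => s_0.
  have /(all_nthP 0)/(_ h.-1) := angles; rewrite size_map size_s => /(_ ltS).
  by rewrite (nth_map 0) ?size_s // s_0 acos0 ltxx.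
move: s_gt0; rewrite -rank_gt_svals prednK // => /leq_trans; apply.
rewrite -VP QE !adjM adjK -!mulmxA; apply: leq_trans (mxrankM_maxr _ _) _.
by apply: leq_trans (mxrankM_maxr _ _) _; rewrite mulmxA mxrankM_maxl.
Qed.

End Compatibility.

Section Angles.
Variables (R : realType) (b : scalar_kind).
Local Notation K := (RorC R b).
Local Notation ofR := (@sc_of_real R b).

(** Let Q and Q' be orthonormal bases of R(X) and R(P^* X).  As T lies in the
    range of P, P^* is isometric on T.  For v in T the vector Q^* v is the image
    of Q'^* P^* v under the contraction Q^* P Q', so each cosine can only
    increase. *)
Lemma Theta_compression n r k p (P : 'M[K]_(n, k)) (X : 'M[K]_(n, r)) (E : 'M[K]_(k, p)) i :
  orthonormal_cols P ->
  orthonormal_cols E ->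
  let S := colrange X in let T := colrange (P *m E) in
  let S' := colrange (adj P *m X) in let T' := colrange E in
  (p <= \dim S')%N -> (i < p)%N ->
  (Theta S' T')`_i <= (Theta S T)`_i.
Proof.
move=> PP EE S T S' T' p_le ip.
have onbT' : is_onb T' E by [].
have onbT : is_onb T (P *m E) by split=> //; apply: orthonormal_mul.
have le_dim : (\dim S' <= \dim S)%N by rewrite !dim_colrange mxrankM_maxr.
have dT := is_onb_dim onbT; have dT' := is_onb_dim onbT'.
have [QQ RQ] := onb_mxP S; have [QQ' RQ'] := onb_mxP S'.
have [TT RT] := onb_mxP T; have [TT' RT'] := onb_mxP T'.
have onbQ' := onb_mxP S'.
rewrite /Theta; set Q := onb_mx S in QQ RQ *; set Q' := onb_mx S' in QQ' RQ' onbQ' *.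
set M := onb_mx T in TT RT *; set M' := onb_mx T' in TT' RT' *.
have le_s : (svals (adj Q *m M))`_i <= (svals (adj Q' *m M'))`_i.
  have PPM : P *m (adj P *m M) = M.
    have /colrange_subP[C ->] : (colrange M <= colrange (P *m E))%VS by rewrite RT subvv.
    by rewrite -mulmxA (mulmxA (adj P)) PP mul1mx.
  have M'K : M' *m (adj M' *m (adj P *m M)) = adj P *m M.
    apply: onb_projK (onb_mxP T') _.
    have /colrange_subP[C ->] : (colrange M <= colrange (P *m E))%VS by rewrite RT subvv.
    by apply/colrange_subP; exists C; rewrite -mulmxA (mulmxA (adj P)) PP mul1mx.
  have Q'K : Q' *m (adj Q' *m (adj P *m Q)) = adj P *m Q.
    apply: onb_projK onbQ' _.
    have /colrange_subP[C ->] : (colrange Q <= colrange X)%VS by rewrite RQ subvv.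
    by apply/colrange_subP; exists C; rewrite mulmxA.
  rewrite -[leRHS]mul1r.
  apply: (@svals_comparison _ _ _ _ _ _ _ _ (adj M' *m (adj P *m M)) _ _ _
            (svalsP _) (svalsP _)) => // x.
    rewrite expr1n mul1r -!mulmxA; set v := adj P *m (M *m x).
    have -> : M' *m (adj M' *m v) = v.
      by rewrite /v (mulmxA (adj P)) (mulmxA (adj M')) (mulmxA M') M'K.
    have EQ : adj Q *m (M *m x) = adj Q *m (P *m (Q' *m (adj Q' *m v))).
      have QP : adj Q *m P = adj Q *m P *m Q' *m adj Q'.
        by have := congr1 (@adj _ _ _ _) Q'K; rewrite !adjM !adjK => ->.
      have -> : M *m x = P *m v by rewrite /v (mulmxA (adj P)) (mulmxA P) PPM.
      by rewrite mulmxA QP -!mulmxA.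
    have le1 : fro2 (adj Q *m (M *m x)) <= fro2 (adj Q' *m v).
      rewrite EQ (le_trans (fro2_adj_le _ QQ)) //.
      by rewrite fro2_isom // fro2_isom.
    have le2 : fro2 (adj M' *m v) <= fro2 x.
      rewrite (le_trans (fro2_adj_le _ TT')) // (le_trans (fro2_adj_le _ PP)) //.
      by rewrite fro2_isom.
    by rewrite ler_pM ?fro2_ge0.
  move=> Fx0; have PM0 : adj P *m M *m x = 0 by rewrite -M'K -mulmxA Fx0 mulmx0.
  by rewrite -mulmxA -PPM -(mulmxA P) PM0 !mulmx0.
have /andP[s0 s1] := svals_cross_le1 i QQ TT.
have /andP[s0' s1'] := svals_cross_le1 i QQ' TT'.
have dimT : \dim T = p by rewrite -dT.
have dimT' : \dim T' = p by rewrite -dT'.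
have size1 : (i < size (svals (adj Q *m M)))%N.
  by rewrite size_svals leq_min dimT ip andbT (leq_trans ip) // (leq_trans p_le).
have size2 : (i < size (svals (adj Q' *m M')))%N.
  by rewrite size_svals leq_min dimT' ip andbT (leq_trans ip).
rewrite !(nth_map 0) //.
have acos_itv (y : R) : 0 <= y -> y <= 1 -> -1 <= y <= 1.
  by move=> y0 ->; rewrite (le_trans _ y0) // oppr_le0.
have [le0 _] := acos_def (acos_itv _ s0 s1); have [le0' _] := acos_def (acos_itv _ s0' s1').
by rewrite leNgt -ltr_cos ?in_itv /= ?le0 ?le0' // !acosK ?in_itv /= ?acos_itv // -leNgt.
Qed.

End Angles.

(** * Angles between the Krylov space and a dominant subspace *)

Section KrylovBound.
Variables (R : realType) (b : scalar_kind).
Local Notation K := (RorC R b).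
Local Notation ofR := (@sc_of_real R b).

(** The projection onto the orthogonal complement of S annihilates M and is a
    contraction. *)
Lemma mxnorm_le_of_range nu N d e (S T : {vspace 'cV[K]_N}) (P M : 'M[K]_(N, e))
    (Q : 'M[K]_(N, d)) :
  is_onb S Q -> is_onb T P -> (e <= d)%N -> (colrange M <= S)%VS ->
  mxnorm nu (sin_Theta S T) <= mxnorm nu (P - M).
Proof.
move=> SQ TP ed MS; have [QQ _] := SQ; rewrite (mxnorm_sin_Theta nu SQ TP ed).
have -> : P - Q *m (adj Q *m P) = (1%:M - Q *m adj Q) *m (P - M).
  rewrite mulmxBl mul1mx -mulmxA !mulmxBr (onb_projK SQ MS).
  by rewrite opprB addrA subrK.
rewrite -[leRHS]mul1r; apply: mxnorm_mulmx_left => // x.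
rewrite expr1n mul1r [leRHS](fro2_proj x QQ) mulmxBl mul1mx -mulmxA.
by rewrite lerDr fro2_ge0.
Qed.

(** The matrix M = psi(A) X Z^+ G has range in the Krylov space for every G.
    If the range of G lies in that of Z = V_k^* X then Z Z^+ G = G, so M splits
    into U_k D G, with D = psi(Sigma_k), and a tail on which psi is at most alpha.
    The choice of G for which D G is the projection of T onto D W makes U_k D G
    the best approximation of U_k T, and |G| <= 1 because D >= 1. *)
Lemma krylov_sin_bound nu m n r h k j w t (A : 'M[K]_(m, n)) U V (X : 'M[K]_(n, r))
    (f : {poly R}) (alpha : R) (T : 'M[K]_(k, h)) (Q : 'M[K]_(k, w)) :
  let psi x := x * f.[x ^+ 2] in
  let Z := adj (first_cols k V) *m X in
  full_svd A U V -> (k <= m)%N -> (k <= n)%N -> (j <= k)%N -> (size f <= t.+1)%N ->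
  (forall i, (i < k)%N -> 1 <= psi (svals A)`_i) ->
  (forall i, (j <= i)%N -> (i < k)%N -> psi (svals A)`_i = 1) ->
  0 <= alpha -> (forall i, (k <= i)%N -> `|psi (svals A)`_i| <= alpha) ->
  is_onb (colrange Z) Q -> (h <= \rank Z)%N -> orthonormal_cols T ->
  (forall (a : 'I_k) (c : 'I_h), (c < j)%N -> T a c = (a == c :> nat)%:R) ->
  (forall (a : 'I_k) (c : 'I_h), (a < j)%N -> (j <= c)%N -> T a c = 0) ->
  (forall c : 'I_h, (j <= c)%N -> exists y, col c T = Z *m y) ->
  mxnorm nu (sin_Theta (krylov t A X) (colrange (first_cols k U *m T))) <=
  mxnorm nu (first_cols j 1%:M - Q *m (adj Q *m first_cols j 1%:M)) +
  alpha * mxnorm nu (adj (last_cols k V) *m X *m mp_inverse Z).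
Proof.
move=> psi Z svdA km kn jk sf psi1 psiE alpha0 psi_le WQ hZ TT Tl T0 TZ.
have [UU VV EA] := svdA; set s := svals A in psi1 psiE psi_le.
pose wt := map psi s; have wtE i : wt`_i = psi s`_i.
  by rewrite nth_map_zero // /psi mul0r.
pose B := U *m rdiag m n (map ofR wt) *m adj V.
have BK : (colrange (B *m X) <= krylov t A X)%VS by apply: svd_poly_krylov.
pose d (c : 'I_k) := wt`_c.
have d1 c : 1 <= d c by rewrite /d wtE psi1.
have BVk : B *m first_cols k V = first_cols k U *m real_diag b d by apply: svd_first_cols.
have UkUk := orthonormal_first_cols km UU.
(* psi does not vanish on the first k singular values, so the Krylov space is
   large enough for its angles with an h-dimensional subspace to be h in number. *)
have rankBX : (\rank Z <= \rank (B *m X))%N.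
  apply: rank_le_kernel => x; rewrite -(mulmxA B) /Z -(mulmxA (adj _)) => BXx.
  have : fro2 (B *m (X *m x)) = 0 by rewrite BXx fro2_0.
  rewrite /B -!mulmxA fro2_isom // fro2_rdiag_mul; last by rewrite size_map size_svals.
  move/eqP; rewrite psumr_eq0 => [/allP all0|c _]; last by rewrite mulr_ge0 ?sqr_ge0.
  apply/matrixP => i e; rewrite ord1 [RHS]mxE; apply/eqP.
  have -> : (adj (first_cols k V) *m (X *m x)) i 0 = (adj V *m (X *m x)) (widen_ord kn i) 0.
    rewrite !mxE; apply: eq_bigr => a _.
    by rewrite !adjE (first_cols_widen kn).
  have := all0 (widen_ord kn i) (mem_index_enum _).
  rewrite mulf_eq0 => /orP[|]; rewrite sqrf_eq0 ?sc_abs_eq0 //= wtE.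
  by rewrite gt_eqF // (lt_le_trans ltr01) ?psi1.
have SK := onb_mxP (krylov t A X).
have dimK : (h <= \dim (krylov t A X))%N.
  apply: leq_trans hZ (leq_trans rankBX _).
  by rewrite -(dim_colrange (B *m X)) dimvS.
have onbS : is_onb (colrange (first_cols k U *m T)) (first_cols k U *m T).
  by split=> //; apply: orthonormal_mul.
pose D := real_diag b d.
have WD := onb_mxP (colrange (D *m Z)); have [PP RP] := WD.
set P := onb_mx (colrange (D *m Z)) in WD PP RP.
have [C PE] : exists C, P = D *m Z *m C by apply/colrange_subP; rewrite RP subvv.
(* This is D^-1 P P^* T, written so that its range visibly lies in that of Z. *)
pose G := Z *m (C *m (adj P *m T)).
have DG : D *m G = P *m (adj P *m T) by rewrite /G !mulmxA -PE -!mulmxA.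
have ZG : Z *m mp_inverse Z *m G = G by rewrite /G mulmxA mp_inverseK.
have G_le (x : 'cV_h) : fro2 (G *m x) <= 1 ^+ 2 * fro2 x.
  rewrite expr1n mul1r (le_trans (fro2_real_diag _ d1)) // mulmxA DG -!mulmxA.
  by rewrite fro2_isom // (le_trans (fro2_adj_le _ PP)) // fro2_isom.
pose M := B *m X *m (mp_inverse Z *m G).
have MK : (colrange M <= krylov t A X)%VS.
  by apply: subv_trans BK; apply/colrange_subP; exists (mp_inverse Z *m G).
apply: le_trans (mxnorm_le_of_range nu SK onbS dimK MK) _.
have ME : M = first_cols k U *m (P *m (adj P *m T)) +
    B *m last_cols k V *m ((adj (last_cols k V) *m X *m mp_inverse Z) *m G).
  rewrite /M -[B in LHS]mulmx1 -(first_last_cols_split kn VV) mulmxDr !mulmxDl.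
  congr (_ + _); last by rewrite !mulmxA.
  rewrite (mulmxA B) BVk -DG -{2}ZG /Z !mulmxA.
  by [].
have -> : first_cols k U *m T - M = first_cols k U *m (T - P *m (adj P *m T)) +
    - (B *m last_cols k V *m ((adj (last_cols k V) *m X *m mp_inverse Z) *m G)).
  by rewrite ME mulmxBr opprD addrA.
apply: le_trans (mxnorm_triangle _ _ _) _; rewrite mxnormN; apply: lerD.
  apply: (@le_trans _ _ (mxnorm nu (T - P *m (adj P *m T)))).
    rewrite -[leRHS]mul1r; apply: mxnorm_mulmx_left => // x.
    by rewrite fro2_isom // expr1n mul1r.
  apply: (stretched_frame_gap nu jk d1 _ WQ WD Tl T0 TZ) => i ji.
  by rewrite /d wtE psiE.
apply: (@le_trans _ _ (alpha * mxnorm nu ((adj (last_cols k V) *m X *m mp_inverse Z) *m G))).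
  apply: mxnorm_mulmx_left => // y; apply: svd_last_cols_bound => //.
    by rewrite size_map size_svals.
  by move=> i ki; rewrite wtE psi_le.
rewrite ler_wpM2l // -[leRHS]mul1r.
exact: mxnorm_mulmx_right.
Qed.

(** The frame T mixes the vectors u_l only among those with equal singular
    values, so its image under U_k is a dominant subspace. *)
Lemma left_dominant_frame m n h k j (A : 'M[K]_(m, n)) U V (T : 'M[K]_(k, h)) :
  full_svd A U V -> (k <= m)%N -> (h <= k)%N ->
  (forall i, (j <= i)%N -> (i < k)%N -> (svals A)`_i = (svals A)`_h.-1) ->
  orthonormal_cols T ->
  (forall (a : 'I_k) (c : 'I_h), (c < j)%N -> T a c = (a == c :> nat)%:R) ->
  (forall (a : 'I_k) (c : 'I_h), (a < j)%N -> (j <= c)%N -> T a c = 0) ->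
  left_dominant A h (colrange (first_cols k U *m T)).
Proof.
move=> svdA km hk tie TT Tl T0; have [UU VV EA] := svdA.
have oUT : orthonormal_cols (first_cols k U *m T).
  by apply: orthonormal_mul => //; apply: orthonormal_first_cols.
split; first by rewrite dim_colrange rank_orthonormal.
exists (first_cols k U *m T); split=> // i.
rewrite -col_mul mulmxA -first_cols_mul (svd_left_eigen svdA).
have -> : first_cols k (U *m real_diag b (fun a : 'I_m => (svals A)`_a ^+ 2)) =
    first_cols k U *m real_diag b (fun a : 'I_k => (svals A)`_a ^+ 2).
  apply/matrixP => a c; rewrite (first_cols_widen km) !mul_mx_diag !mxE.
  by rewrite -(first_cols_widen km) mxE.
rewrite -mulmxA !col_mul scalemxAr; congr (_ *m _).
apply/matrixP => a e; rewrite mul_real_diag !mxE /sigmaK /= -rmorphXn /=.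
have ik : (i < k)%N by apply: leq_trans hk.
have [ij|ji] := ltnP i j; first by rewrite Tl //; case: eqP => [->//|_]; rewrite !mulr0.
have [aj|ja] := ltnP a j; first by rewrite T0 // !mulr0.
by rewrite !tie.
Qed.

End KrylovBound.

(** * Bound for the sines, and comparison of the angles *)

Theorem theorem3p2 (R : realType) (b : scalar_kind) (m n r : nat)
    (A : 'M[RorC R b]_(m, n)) (h j k : nat)
    (h_ge1 : (1 <= h)%N) (h_le : (h <= \rank A)%N)
    (def_j : j = j_index A h) (def_k : k = k_index A h)
    (U : 'M[RorC R b]_m) (V : 'M[RorC R b]_n) (svdA : full_svd A U V)
    (t : nat) (phi : {poly RorC R b})
    (phi_deg : (size phi <= (2 * t + 1).+1)%N)
    (phi_odd : forall i : nat, ~~ odd i -> phi`_i = 0)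
    (phi_pos : forall l : nat, (1 <= l <= k)%N -> 0 < phi.[sigmaK A l])
    (X : 'M[RorC R b]_(n, r)) (compat : h_compatible A X h) :
  let Vk := first_cols k V in
  let Vk_perp := last_cols k V in
  let VVj := colrange (first_cols j V) in
  let phiS := diag_apply phi (ul_block k (Sigma A)) in
  let phiS_perp := diag_apply phi (lr_block k (Sigma A)) in
  let VkX := adj Vk *m X in
  let W := colrange VkX in
  let Ej := mximage (adj Vk) VVj in
  (exists S' : {vspace 'cV[RorC R b]_m},
     left_dominant A h S' /\
     forall nu : norm_kind,
       mxnorm nu (sin_Theta (krylov t A X) S') <=
         (if j == 0%N then 0 else 2 * mxnorm nu (sin_Theta W Ej)) +
         (if k == \rank A then 0
          else mxnorm Spectral phiS_perp * mxnorm Spectral (invmx phiS) *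
               mxnorm nu (adj Vk_perp *m X *m mp_inverse VkX))) /\
  (size (Theta W Ej) = size (Theta (colrange X) VVj) /\
   forall i : nat, (i < size (Theta W Ej))%N ->
     (Theta W Ej)`_i <= (Theta (colrange X) VVj)`_i).
Proof.
move=> Vk Vk_perp VVj phiS phiS_perp VkX W Ej.
have [UU VV EA] := svdA; have sA := svalsP A.
set s := svals A in sA; set sig := s`_h.-1.
have lt_jh : (j < h)%N by rewrite def_j j_index_lt.
have le_hk : (h <= k)%N by rewrite def_k k_index_ge.
have [le_kr s_k] : (k <= \rank A)%N /\ s`_k.-1 = sig.
  by rewrite def_k; apply: k_index_spec.
have tie i : (j <= i)%N -> (i < k)%N -> s`_i = sig.
  by rewrite def_j def_k; apply: index_tie.
have gap i : (k <= i)%N -> s`_i < sig by rewrite def_k; apply: k_index_gap.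
have le_jk : (j <= k)%N by rewrite ltnW // (leq_trans lt_jh).
have k_gt0 : (0 < k)%N by apply: leq_trans le_hk.
have km : (k <= m)%N := leq_trans le_kr (rank_leq_row A).
have kn : (k <= n)%N := leq_trans le_kr (rank_leq_col A).
have sig_gt0 : 0 < sig by rewrite /sig -rank_gt_svals prednK.
have phi_at l : (l < k)%N -> 0 < phi.[sc_of_real b s`_l].
  by move=> lk; apply: (phi_pos l.+1).
have phi_sig : 0 < phi.[sc_of_real b sig].
  by rewrite -s_k phi_at // prednK.
have [f [sf f_sig f_ge f_le]] :=
  monotone_filter phi_deg phi_odd sig_gt0 (lt0r_neq0 phi_sig).
have ge_sig i : (i < k)%N -> sig <= s`_i.
  by move=> ik; rewrite -s_k; apply: (svals_mono sA); rewrite -ltnS prednK.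
have VkVk : orthonormal_cols Vk by apply: orthonormal_first_cols.
pose E := first_cols j (1%:M : 'M[RorC R b]_k).
have EE : orthonormal_cols E.
  by apply: orthonormal_first_cols => //; rewrite /orthonormal_cols adj1 mul1mx.
have VjE : first_cols j V = Vk *m E.
  rewrite -first_cols_mul mulmx1; apply/matrixP => i c.
  rewrite (first_cols_widen (leq_trans le_jk kn)) (first_cols_widen le_jk).
  by rewrite (first_cols_widen kn); congr (V i _); apply: val_inj.
have EjE : Ej = colrange E.
  by rewrite /Ej /VVj mximage_colrange VjE mulmxA VkVk mul1mx.
have onbE : is_onb Ej E by rewrite EjE.
have rankZ : (h <= \rank VkX)%N by apply: compatible_rank svdA kn h_ge1 compat gap.
have dimW : \dim W = \rank VkX by rewrite dim_colrange.
split; last first.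
  have dimEj : \dim Ej = j by rewrite -(is_onb_dim onbE).
  have dimVj : \dim VVj = j.
    by rewrite /VVj VjE dim_colrange rank_orthonormal //; apply: orthonormal_mul.
  have le_jW : (j <= \dim W)%N by rewrite dimW (leq_trans (ltnW lt_jh)).
  have le_jX : (j <= \dim (colrange X))%N.
    by rewrite dim_colrange (leq_trans le_jW) // dimW mxrankM_maxr.
  split; first by rewrite !size_Theta dimEj dimVj (minn_idPr le_jW) (minn_idPr le_jX).
  move=> i; rewrite size_Theta dimEj leq_min => /andP[_ ij].
  by rewrite EjE /VVj VjE; apply: Theta_compression.
have WQ := onb_mxP W; set Q := onb_mx W in WQ; have [QQ RQ] := WQ.
have le_hW : (h <= \dim W)%N by rewrite dimW.
have [T [TT Tl T0 TQ]] := exists_frame QQ (ltnW lt_jh) le_hW le_jk.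
have TZ (c : 'I_h) : (j <= c)%N -> exists y, col c T = VkX *m y.
  move=> /TQ[y ->]; have [C ->] : exists C, Q = VkX *m C.
    by apply/colrange_subP; rewrite RQ subvv.
  by exists (C *m y); rewrite mulmxA.
exists (colrange (first_cols k U *m T)); split.
  exact: left_dominant_frame svdA km le_hk tie TT Tl T0.
move=> nu.
(* The relative size of phi on the tail; past the rank the singular values are 0
   and so are the values of an odd polynomial. *)
pose alpha := if k == \rank A then 0
              else mxnorm Spectral phiS_perp * mxnorm Spectral (invmx phiS).
have alpha_ge0 : 0 <= alpha by rewrite /alpha; case: ifP => // _; rewrite mulr_ge0 ?mxnorm_ge0.
have psi0 i : s`_i = 0 -> `|s`_i * f.[s`_i ^+ 2]| = 0 by move=> ->; rewrite mul0r normr0.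
have psi_le i : (k <= i)%N -> `|s`_i * f.[s`_i ^+ 2]| <= alpha.
  move=> ki; have s_ge0 := svals_ge0 i sA.
  have [i_out|i_in] := leqP (minn m n) i.
    by rewrite psi0 // nth_default // size_svals.
  rewrite /alpha; case: eqP => [kr|_].
    rewrite psi0 //; apply/le_anti; rewrite s_ge0 andbT leNgt.
    by rewrite -rank_gt_svals -kr -leqNgt.
  have [i_m i_n] : (i < m)%N /\ (i < n)%N by apply/andP; rewrite -leq_min.
  have phi_sig0 : sc_abs phi.[sc_of_real b sig] != 0 by rewrite sc_abs_eq0 lt0r_neq0.
  have phi_sig_gt0 : 0 < sc_abs phi.[sc_of_real b sig] by rewrite lt_def phi_sig0 sc_abs_ge0.
  have psi_phi := f_le _ s_ge0 (ltW (gap _ ki)).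
  apply: (@le_trans _ _ (sc_abs phi.[sc_of_real b s`_i] * (sc_abs phi.[sc_of_real b sig])^-1)).
    by rewrite ler_pdivlMr.
  have ltm : (i - k < m - k)%N by lia.
  have ltn : (i - k < n - k)%N by lia.
  rewrite ler_pM ?invr_ge0 ?sc_abs_ge0 //.
    have := spectral_entry phiS_perp (Ordinal ltm) (Ordinal ltn).
    rewrite mxE eqxx mxE /= subnKC // -[i in entry _ i _]/(nat_of_ord (Ordinal i_m)).
    by rewrite -[i in entry _ _ i]/(nat_of_ord (Ordinal i_n)) entryE mxE /= eqxx nth_map_ofR.
  (* The last diagonal entry of phi(Sigma_k)^-1 is 1 / phi(sigma_h). *)
  have phiS_diag : phiS = diag_mx (\row_c phi.[sc_of_real b s`_c]).
    apply/matrixP => c d; rewrite !mxE -val_eqE /=; case: eqP => [Ecd|_]; last by rewrite mulr0n.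
    have cm : (c < m)%N by apply: leq_trans km.
    have dn : (d < n)%N by apply: leq_trans kn.
    rewrite mulr1n -[c : nat]/(nat_of_ord (Ordinal cm)) -[d : nat]/(nat_of_ord (Ordinal dn)).
    by rewrite entryE mxE /= Ecd eqxx nth_map_ofR.
  have phiS_unit : phiS \in unitmx.
    rewrite unitmxE phiS_diag det_diag unitfE; apply/prodf_neq0 => c _.
    by rewrite mxE lt0r_neq0 // phi_at.
  have ltk : (k.-1 < k)%N by rewrite prednK.
  have := spectral_entry (invmx phiS) (Ordinal ltk) (Ordinal ltk).
  apply: le_trans; rewrite -(ler_pM2l phi_sig_gt0) mulfV // -sc_absM.
  have := mulmxV phiS_unit => /matrixP/(_ (Ordinal ltk) (Ordinal ltk)).
  rewrite {1}phiS_diag mul_diag_mx !mxE eqxx /= s_k => ->.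
  by rewrite -(rmorph1 (@sc_of_real R b)) sc_abs_of_real normr1.
have le_gap : mxnorm nu (E - Q *m (adj Q *m E)) <=
    (if j == 0%N then 0 else 2 * mxnorm nu (sin_Theta W Ej)).
  rewrite -(mxnorm_sin_Theta nu WQ onbE); last by rewrite (leq_trans (ltnW lt_jh)).
  case: eqP => [j0|_]; last first.
    by rewrite ler_peMl ?mxnorm_ge0 // ler1n.
  have size0 : size (Theta W Ej) = 0%N.
    by rewrite size_Theta -(is_onb_dim onbE) j0 minn0.
  case: nu => /=; first by rewrite nth_default // size_svals size0.
  rewrite big1 ?sqrtr0 // => -[i lti]; exfalso; by rewrite size0 in lti.
have psi1 i : (i < k)%N -> 1 <= s`_i * f.[s`_i ^+ 2] by move=> /ge_sig; exact: f_ge.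
have psiE i : (j <= i)%N -> (i < k)%N -> s`_i * f.[s`_i ^+ 2] = 1.
  by move=> ji ik; rewrite (tie _ ji ik).
apply: le_trans (krylov_sin_bound nu svdA km kn le_jk sf psi1 psiE alpha_ge0 psi_le
  WQ rankZ TT Tl T0 TZ) _.
apply: lerD => //; rewrite /alpha; case: eqP => _; first by rewrite mul0r.
by [].
Qed.
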